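(* Let $R$ be a ring and $C$ a big cotilting right $R$-module. Let $\mathcal{D}^{\le 0}_C$ and $\mathcal{D}^{\ge 0}_C$ be the full subcategories of $\mathbf{D}(R)$ given by \[ \mathcal{D}^{\le 0}_C = \{ Z \in \mathbf{D}(R) \mid \operatorname{Hom}_{\mathbf{D}(R)}(Z,\Sigma^i C)=0 \text{ for all } i<0 \}, \] \[ \mathcal{D}^{\ge 0}_C = \{ X \in \mathbf{D}(R) \mid \operatorname{Hom}_{\mathbf{D}(R)}(X,\Sigma^i C)=0 \text{ for all } i>0 \}. \] Then $(\mathcal{D}^{\le 0}_C,\mathcal{D}^{\ge 0}_C)$ is a $t$-structure on the derived category $\mathbf{D}(R)$.
   Context: Rings are associative and unital; $\mathbf{D}(R)$ is the unbounded derived category of the category $\mathrm{Mod}\text{-}R$ of right $R$-modules, with suspension functor $\Sigma$. $\operatorname{Prod} C$ denotes the class of all direct summands of products of copies of $C$. A right $R$-module $C$ is big $n$-cotilting ($n\ge 0$) if: (BC1) $C$ has injective dimension at most $n$; (BC2) $\operatorname{Ext}^j_R(C^I,C) = 0$ for every $j>0$ and every set $I$; (BC3) there is an exact sequence $0 \to C_r \to \dots \to C_0 \to Q \to 0$ in $\mathrm{Mod}\text{-}R$ with $Q$ an injective cogenerator of $\mathrm{Mod}\text{-}R$, $r \ge 0$ and all $C_i \in \operatorname{Prod} C$. It is big cotilting if it is big $n$-cotilting for some $n\ge 0$. A $t$-structure on a triangulated category $\mathcal{T}$ is a pair of full subcategories $(\mathcal{D}^{\le 0},\mathcal{D}^{\ge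 0})$ such that, writing $\mathcal{D}^{\le n}=\Sigma^{-n}\mathcal{D}^{\le 0}$ and $\mathcal{D}^{\ge n}=\Sigma^{-n}\mathcal{D}^{\ge 0}$: (tS1) $\operatorname{Hom}_{\mathcal{T}}(A,B)=0$ for all $A\in\mathcal{D}^{\le 0}$, $B\in\mathcal{D}^{\ge 1}$; (tS2) $\mathcal{D}^{\le 0}\subseteq\mathcal{D}^{\le 1}$ and $\mathcal{D}^{\ge 0}\supseteq\mathcal{D}^{\ge 1}$; (tS3) for every $X\in\mathcal{T}$ there is a triangle $A\to X\to B\to\Sigma A$ with $A\in\mathcal{D}^{\le 0}$ and $B\in\mathcal{D}^{\ge 1}$. *)

(* Defs.v *)
From HB Require Import structures.
From mathcomp Require Import all_boot all_order all_algebra.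
From mathcomp Require Import boolp classical_sets functions.

Set Implicit Arguments.
Unset Strict Implicit.
Unset Printing Implicit Defensive.

Import Order.TTheory GRing.Theory Num.Theory.
Local Open Scope ring_scope.

(* MathComp modules are left modules, so a right R-module is a left module
   over the converse ring R^c. *)
Notation rmodType R := (lmodType R^c).

Section Modules.
Variable R : pzRingType.
Implicit Types M N E C Q : rmodType R.

Definition is_zero_mod M : Prop := forall x : M, x = 0.

Definition exact_at M N E (f : {linear M -> N}) (g : {linear N -> E}) : Prop :=
  forall y : N, g y = 0 <-> exists x : M, y = f x.

Definition injective_mod E : Prop :=
  forall (M N : rmodType R) (i : {linear M -> N}) (f : {linear M -> E}),
    injective i -> exists g : {linear N -> E}, forall x, g (i x) = f x.

Definition cogenerator_mod Q : Prop :=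
  forall (M N : rmodType R) (f g : {linear M -> N}),
    (forall h : {linear N -> Q}, forall x, h (f x) = h (g x)) ->
    forall x, f x = g x.

(* 0 -> M -> E 0 -> E 1 -> ... is an injective coresolution of M. *)
Definition inj_coresolution M (E : nat -> rmodType R)
    (eta : {linear M -> E 0%N}) (d : forall i, {linear E i -> E i.+1}) : Prop :=
  [/\ forall i, injective_mod (E i),
      injective eta,
      exact_at eta (d 0%N)
    & forall i, exact_at (d i) (d i.+1)].

Definition inj_dim_le (n : nat) M : Prop :=
  exists (E : nat -> rmodType R) (eta : {linear M -> E 0%N})
         (d : forall i, {linear E i -> E i.+1}),
    inj_coresolution eta d /\ forall i, (n < i)%N -> is_zero_mod (E i).

(* The cohomology of Hom_R(M, E 0) -> Hom_R(M, E 1) -> ... vanishes in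
   degree j. *)
Definition Hom_cohomology_eq0 (j : nat) M (E : nat -> rmodType R)
    (d : forall i, {linear E i -> E i.+1}) : Prop :=
  match j with
  | 0 => forall g : {linear M -> E 0%N},
      (forall x, d 0%N (g x) = 0) -> forall x, g x = 0
  | k.+1 => forall g : {linear M -> E k.+1},
      (forall x, d k.+1 (g x) = 0) ->
      exists h : {linear M -> E k}, forall x, g x = d k (h x)
  end.

(* Ext^j_R(M, N) = 0, where Ext^j_R(M, -) is the j-th right derived functor of
   Hom_R(M, -); its vanishing does not depend on the chosen coresolution. *)
Definition Ext_eq0 (j : nat) M N : Prop :=
  forall (E : nat -> rmodType R) (eta : {linear N -> E 0%N})
         (d : forall i, {linear E i -> E i.+1}),
    inj_coresolution eta d -> Hom_cohomology_eq0 j M d.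

(* M \in Prod C: the type of functions I -> C, with the pointwise structure,
   is the product C^I. *)
Definition in_Prod C M : Prop :=
  exists (I : Type) (N : rmodType R) (phi : {linear (M * N)%type -> (I -> C)}),
    bijective phi.

(* 0 -> Cs r -> ... -> Cs 0 -eps-> Q -> 0 is exact with Q an injective
   cogenerator and all terms in Prod C; the sequence is extended by zero. *)
Definition Prod_resolved_cogenerator C : Prop :=
  exists (Q : rmodType R) (r : nat) (Cs : nat -> rmodType R)
         (eps : {linear Cs 0%N -> Q}) (d : forall i, {linear Cs i.+1 -> Cs i}),
  [/\ injective_mod Q /\ cogenerator_mod Q,
      forall i, (i <= r)%N -> in_Prod C (Cs i),
      forall i, (r < i)%N -> is_zero_mod (Cs i),
      forall q : Q, exists x, q = eps x
    & exact_at (d 0%N) eps /\ forall i, exact_at (d i.+1) (d i)].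

Definition big_n_cotilting (n : nat) C : Prop :=
  [/\ inj_dim_le n C,
      forall (j : nat) (I : Type), (0 < j)%N -> Ext_eq0 j (I -> C) C
    & Prod_resolved_cogenerator C].

Definition big_cotilting C : Prop := exists n : nat, big_n_cotilting n C.

End Modules.

Section Complexes.
Variable R : pzRingType.

Record complex : Type := Complex {
  ob :> int -> rmodType R;
  diff : forall i : int, {linear ob i -> ob (i + 1)};
  diffK : forall (i : int) (x : ob i), diff (i + 1) (diff i x) = 0
}.

Record chain_map (X Y : complex) : Type := ChainMap {
  comp :> forall i : int, {linear X i -> Y i};
  comm_diff : forall (i : int) (x : X i),
    diff Y i (comp i x) = comp (i + 1) (diff X i x)
}.

Lemma id_comm (X : complex) (i : int) (x : X i) :
  diff X i ((idfun : {linear X i -> X i}) x)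
  = (idfun : {linear X (i + 1) -> X (i + 1)}) (diff X i x).
Proof. by []. Qed.

Definition id_map (X : complex) : chain_map X X :=
  @ChainMap X X (fun i => idfun : {linear X i -> X i}) (@id_comm X).

Lemma comp_comm (X Y Z : complex) (g : chain_map Y Z) (f : chain_map X Y)
    (i : int) (x : X i) :
  diff Z i ((g i \o f i : {linear X i -> Z i}) x)
  = (g (i + 1) \o f (i + 1) : {linear X (i + 1) -> Z (i + 1)}) (diff X i x).
Proof. by rewrite /= comm_diff comm_diff. Qed.

Definition comp_map (X Y Z : complex) (g : chain_map Y Z) (f : chain_map X Y) :
    chain_map X Z :=
  @ChainMap X Z (fun i => g i \o f i : {linear X i -> Z i}) (comp_comm g f).

Lemma zero_comm (X Y : complex) (i : int) (x : X i) :
  diff Y i ((\0 : {linear X i -> Y i}) x)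
  = (\0 : {linear X (i + 1) -> Y (i + 1)}) (diff X i x).
Proof. exact: linear0. Qed.

Definition zero_map (X Y : complex) : chain_map X Y :=
  @ChainMap X Y (fun i => \0 : {linear X i -> Y i}) (@zero_comm X Y).

(* f induces an injection, resp. a surjection, on
   H^(i+1)(X) = ker (diff X (i + 1)) / im (diff X i); every integer is of the
   form i + 1. *)
Definition quasi_iso (X Y : complex) (f : chain_map X Y) : Prop :=
  forall i : int,
    (forall x : X (i + 1), diff X (i + 1) x = 0 ->
       (exists y : Y i, f (i + 1) x = diff Y i y) ->
       exists x' : X i, x = diff X i x') /\
    (forall y : Y (i + 1), diff Y (i + 1) y = 0 ->
       exists x : X (i + 1), diff X (i + 1) x = 0 /\
       exists y' : Y i, y - f (i + 1) x = diff Y i y').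

Definition stalk_ob (M : rmodType R) (i : int) : rmodType R :=
  if i == 0 then M else 'rV[R^c]_0.

(* The module M regarded as a complex concentrated in degree 0. *)
Definition stalk (M : rmodType R) : complex :=
  @Complex (stalk_ob M)
    (fun i => \0 : {linear stalk_ob M i -> stalk_ob M (i + 1)})
    (fun i x => erefl).

Definition transport (X : int -> rmodType R) (i j : int) (e : i = j) :
    {linear X i -> X j} :=
  match e in _ = k return {linear X i -> X k} with
  | erefl => (idfun : {linear X i -> X i})
  end.

(* (-1)^k f *)
Definition sign_lin (k : int) (M N : rmodType R) (f : {linear M -> N}) :
    {linear M -> N} :=
  if odd `|k|%N then (\- f : {linear M -> N}) else f.

Lemma sign_linE (k : int) (M N : rmodType R) (f : {linear M -> N}) (x : M) :
  sign_lin k f x = if odd `|k|%N then - f x else f x.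
Proof. by rewrite /sign_lin; case: ifP. Qed.

Lemma sign_lin_comp0 (k : int) (M N E : rmodType R) (f : {linear M -> N})
    (g : {linear N -> E}) (x : M) :
  g (f x) = 0 -> sign_lin k g (sign_lin k f x) = 0.
Proof.
by move=> gf; rewrite !sign_linE; case: (odd _) => //; rewrite (linearN g) gf !oppr0.
Qed.

(* Sigma^k X has X^(i+k) in degree i and differential (-1)^k d. *)
Section Shift.
Variable k : int.

Lemma shift_index (i : int) : i + k + 1 = i + 1 + k.
Proof. exact: addrAC. Qed.

Definition shift_diff (X : complex) (i : int) :
    {linear X (i + k) -> X (i + 1 + k)} :=
  sign_lin k (transport X (shift_index i) \o diff X (i + k)).

Lemma transport_diffK (X : complex) (m n : int) (e : m + 1 = n) (x : X m) :
  diff X n (transport X e (diff X m x)) = 0.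
Proof. by case: n / e => /=; rewrite diffK. Qed.

Lemma shift_diffK (X : complex) (i : int) (x : X (i + k)) :
  shift_diff X (i + 1) (shift_diff X i x) = 0.
Proof.
by apply: sign_lin_comp0; rewrite /= transport_diffK linear0.
Qed.

Definition shift (X : complex) : complex :=
  @Complex (fun i => X (i + k)) (shift_diff X) (@shift_diffK X).

Lemma transport_comp (X Y : complex) (f : chain_map X Y) (m n : int)
    (e : m = n) (x : X m) :
  transport Y e (f m x) = f n (transport X e x).
Proof. by case: n / e. Qed.

Lemma shift_map_comm (X Y : complex) (f : chain_map X Y) (i : int)
    (x : shift X i) :
  diff (shift Y) i (f (i + k) x) = f (i + 1 + k) (diff (shift X) i x).
Proof.
rewrite /= /shift_diff !sign_linE /= comm_diff transport_comp.
by case: (odd _) => //; rewrite (linearN (f _)).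
Qed.

Definition shift_map (X Y : complex) (f : chain_map X Y) :
    chain_map (shift X) (shift Y) :=
  @ChainMap (shift X) (shift Y) (fun i => f (i + k)) (shift_map_comm f).

End Shift.

(* In degree i the cone of f is X^(i+1) + Y^i, with differential
   (x, y) |-> (- d x, f x + d y). *)
Section Cone.
Variables (X Y : complex) (f : chain_map X Y).

Definition cone_ob (i : int) : rmodType R := (X (i + 1)%R * Y i)%type.

Definition cone_fun (i : int) (p : cone_ob i) : cone_ob (i + 1) :=
  (- diff X (i + 1) p.1, f (i + 1) p.1 + diff Y i p.2).

Lemma cone_fun_linear (i : int) : linear (@cone_fun i).
Proof.
move=> a [x1 y1] [x2 y2]; rewrite /cone_fun /=.
apply: injective_projections => /=; rewrite !linearP ?opprD ?scalerN //=.
by rewrite scalerDr addrACA.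
Qed.

HB.instance Definition _ (i : int) :=
  GRing.isLinear.Build R^c (cone_ob i) (cone_ob (i + 1)) _ (@cone_fun i)
    (@cone_fun_linear i).

Lemma cone_diffK (i : int) (p : cone_ob i) : cone_fun (cone_fun p) = 0.
Proof.
apply: injective_projections; rewrite /cone_fun /=.
  by rewrite linearN diffK !oppr0.
by rewrite linearD /= diffK addr0 linearN /= comm_diff addNr.
Qed.

Definition cone : complex :=
  @Complex cone_ob (fun i => @cone_fun i : {linear cone_ob i -> cone_ob (i + 1)})
    cone_diffK.

Definition cone_in_fun (i : int) (y : Y i) : cone i := (0, y).

Lemma cone_in_linear (i : int) : linear (@cone_in_fun i).
Proof.
by move=> a x y; apply: injective_projections; rewrite //= scaler0 addr0.
Qed.

HB.instance Definition _ (i : int) :=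
  GRing.isLinear.Build R^c (Y i) (cone i) _ (@cone_in_fun i)
    (@cone_in_linear i).

Lemma cone_in_comm (i : int) (y : Y i) :
  diff cone i (cone_in_fun y) = cone_in_fun (diff Y i y).
Proof.
by apply: injective_projections; rewrite //= linear0 ?oppr0 ?add0r.
Qed.

Definition cone_in : chain_map Y cone :=
  @ChainMap Y cone (fun i => @cone_in_fun i : {linear Y i -> cone i})
    cone_in_comm.

Definition cone_out_fun (i : int) (p : cone i) : shift 1 X i := p.1.

Lemma cone_out_linear (i : int) : linear (@cone_out_fun i).
Proof. by []. Qed.

HB.instance Definition _ (i : int) :=
  GRing.isLinear.Build R^c (cone i) (shift 1 X i) _ (@cone_out_fun i)
    (@cone_out_linear i).

Lemma cone_out_comm (i : int) (p : cone i) :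
  diff (shift 1 X) i (cone_out_fun p) = cone_out_fun (diff cone i p).
Proof.
rewrite /= /shift_diff /sign_lin /= /cone_out_fun /=.
by rewrite (eq_irrelevance (shift_index 1 i) erefl).
Qed.

Definition cone_out : chain_map cone (shift 1 X) :=
  @ChainMap cone (shift 1 X)
    (fun i => @cone_out_fun i : {linear cone i -> shift 1 X i}) cone_out_comm.

End Cone.

Lemma shift_quasi_iso (k : int) (X Y : complex) (f : chain_map X Y) :
  quasi_iso f -> quasi_iso (shift_map k f).
Proof.
move=> qf i.
have qt (m n : int) (e : m + 1 = n) :
    (forall x : X n, diff X n x = 0 ->
       (exists y : Y m, f n x = transport Y e (diff Y m y)) ->
       exists x' : X m, x = transport X e (diff X m x')) /\
    (forall y : Y n, diff Y n y = 0 ->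
       exists x : X n, diff X n x = 0 /\
       exists y' : Y m, y - f n x = transport Y e (diff Y m y')).
  by case: n / e; exact: qf.
have d0 (Z : complex) (z : Z (i + 1 + k)) :
    shift_diff k Z (i + 1) z = 0 <-> diff Z (i + 1 + k) z = 0.
  rewrite /shift_diff sign_linE /=.
  have t0 (m n : int) (e : m = n) (w : Z m) : transport Z e w = 0 <-> w = 0.
    by case: n / e.
  apply: iff_trans (t0 _ _ (shift_index k (i + 1)) _).
  case: (odd _) => //; split=> [/eqP|->]; last by rewrite oppr0.
  by rewrite oppr_eq0 => /eqP.
have im (Z : complex) (z : Z (i + 1 + k)) :
    (exists w, z = shift_diff k Z i w) <->
    (exists w, z = transport Z (shift_index k i) (diff Z (i + k) w)).
  rewrite /shift_diff; split=> -[w ->]; rewrite ?sign_linE /=.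
    by case: (odd _); [exists (- w); rewrite !linearN | exists w].
  by case: (boolP (odd `|k|)) => ok; [exists (- w) | exists w];
     rewrite sign_linE /= ?ok ?(negPf ok) ?linearN ?opprK.
have [qinj qsurj] := qt _ _ (shift_index k i).
split=> [x /d0 dx /im /qinj xE|y /d0 /qsurj [x [dx yE]]].
  by apply/im/xE.
by exists x; split; [apply/d0 | apply/im].
Qed.

End Complexes.

(* The derived category D(R) is the localization of the category of complexes
   at the quasi-isomorphisms. Its objects are the complexes and its morphisms
   are the formal composites of chain maps and formal inverses of
   quasi-isomorphisms, taken modulo the congruence Deq.  Chain homotopic maps
   need not be identified separately: they already agree in the localization,
   because the projection of the cylinder of a complex is a quasi-isomorphism. *)
Section DerivedCategory.
Variable R : pzRingType.
Implicit Types X Y Z W : complex R.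

Inductive Dmor : complex R -> complex R -> Type :=
| Dloc X Y (f : chain_map X Y) : Dmor X Y
| Dinv X Y (s : chain_map X Y) (qs : quasi_iso s) : Dmor Y X
| Dcomp X Y Z (v : Dmor Y Z) (u : Dmor X Y) : Dmor X Z.

Inductive Deq : forall X Y, Dmor X Y -> Dmor X Y -> Prop :=
| Deq_refl X Y (u : Dmor X Y) : Deq u u
| Deq_sym X Y (u v : Dmor X Y) : Deq u v -> Deq v u
| Deq_trans X Y (u v w : Dmor X Y) : Deq u v -> Deq v w -> Deq u w
| Deq_comp X Y Z (v v' : Dmor Y Z) (u u' : Dmor X Y) :
    Deq v v' -> Deq u u' -> Deq (Dcomp v u) (Dcomp v' u')
| Deq_assoc X Y Z W (w : Dmor Z W) (v : Dmor Y Z) (u : Dmor X Y) :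
    Deq (Dcomp w (Dcomp v u)) (Dcomp (Dcomp w v) u)
| Deq_idl X Y (u : Dmor X Y) : Deq (Dcomp (Dloc (id_map Y)) u) u
| Deq_idr X Y (u : Dmor X Y) : Deq (Dcomp u (Dloc (id_map X))) u
| Deq_loc_ext X Y (f g : chain_map X Y) :
    (forall i x, f i x = g i x) -> Deq (Dloc f) (Dloc g)
| Deq_loc_comp X Y Z (g : chain_map Y Z) (f : chain_map X Y) :
    Deq (Dloc (comp_map g f)) (Dcomp (Dloc g) (Dloc f))
| Deq_invl X Y (s : chain_map X Y) (qs : quasi_iso s) :
    Deq (Dcomp (Dinv qs) (Dloc s)) (Dloc (id_map X))
| Deq_invr X Y (s : chain_map X Y) (qs : quasi_iso s) :
    Deq (Dcomp (Dloc s) (Dinv qs)) (Dloc (id_map Y)).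

Definition DHom_eq0 X Y : Prop :=
  forall u : Dmor X Y, Deq u (Dloc (zero_map X Y)).

Definition Diso X Y (u : Dmor X Y) : Prop :=
  exists v : Dmor Y X,
    Deq (Dcomp v u) (Dloc (id_map X)) /\ Deq (Dcomp u v) (Dloc (id_map Y)).

Fixpoint Dshift (k : int) X Y (u : Dmor X Y) : Dmor (shift k X) (shift k Y) :=
  match u in Dmor X Y return Dmor (shift k X) (shift k Y) with
  | Dloc _ _ f => Dloc (shift_map k f)
  | Dinv _ _ s qs => Dinv (shift_quasi_iso k qs)
  | Dcomp _ _ _ v u => Dcomp (Dshift k v) (Dshift k u)
  end.

Lemma Deq_shift (k : int) X Y (u v : Dmor X Y) :
  Deq u v -> Deq (Dshift k u) (Dshift k v).
Proof.
elim=> {X Y u v} /=.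
- by move=> *; apply: Deq_refl.
- by move=> *; apply: Deq_sym.
- by move=> X Y u v w _ uv _ vw; apply: Deq_trans uv vw.
- by move=> *; apply: Deq_comp.
- by move=> *; apply: Deq_assoc.
- move=> X Y u; apply: Deq_trans (Deq_idl (Dshift k u)).
  by apply: Deq_comp; [apply: Deq_loc_ext | apply: Deq_refl].
- move=> X Y u; apply: Deq_trans (Deq_idr (Dshift k u)).
  by apply: Deq_comp; [apply: Deq_refl | apply: Deq_loc_ext].
- by move=> X Y f g fg; apply: Deq_loc_ext => i x; apply: fg.
- move=> X Y Z g f; apply: Deq_trans (Deq_loc_comp _ _).
  exact: Deq_loc_ext.
- move=> X Y s qs; apply: Deq_trans (Deq_invl _) _; exact: Deq_loc_ext.
- move=> X Y s qs; apply: Deq_trans (Deq_invr _) _; exact: Deq_loc_ext.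
Qed.

(* X -u-> Y -v-> Z -w-> Sigma X is isomorphic in D(R) to the standard triangle
   X' -f-> Y' -> cone f -> Sigma X' of some chain map f. *)
Definition distinguished X Y Z (u : Dmor X Y) (v : Dmor Y Z)
    (w : Dmor Z (shift 1 X)) : Prop :=
  exists (X' Y' : complex R) (f : chain_map X' Y')
         (a : Dmor X' X) (b : Dmor Y' Y) (c : Dmor (cone f) Z),
  [/\ Diso a, Diso b & Diso c] /\
  [/\ Deq (Dcomp b (Dloc f)) (Dcomp u a),
      Deq (Dcomp c (Dloc (cone_in f))) (Dcomp v b)
    & Deq (Dcomp (Dshift 1 a) (Dloc (cone_out f))) (Dcomp w c)].

(* Full subcategories of D(R), given by their objects. *)
Definition Dsub : Type := complex R -> Prop.

(* The full subcategory Sigma^(-n) P; as Sigma is an automorphism, X belongs to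
   it if and only if Sigma^n X belongs to P. *)
Definition Dsub_deg (P : Dsub) (n : int) : Dsub := fun X => P (shift n X).

(* (Dle, Dge) plays the role of (D^{<= 0}, D^{>= 0}). *)
Definition t_structure (Dle Dge : Dsub) : Prop :=
  [/\ forall A B, Dle A -> Dsub_deg Dge 1 B -> DHom_eq0 A B,
      (forall X, Dle X -> Dsub_deg Dle 1 X) /\
      (forall X, Dsub_deg Dge 1 X -> Dge X)
    & forall X, exists (A B : complex R)
        (u : Dmor A X) (v : Dmor X B) (w : Dmor B (shift 1 A)),
        [/\ Dle A, Dsub_deg Dge 1 B & distinguished u v w]].

Definition D_le0 (C : rmodType R) : Dsub :=
  fun Z => forall i : int, i < 0 -> DHom_eq0 Z (shift i (stalk C)).

Definition D_ge0 (C : rmodType R) : Dsub :=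
  fun X => forall i : int, 0 < i -> DHom_eq0 X (shift i (stalk C)).

End DerivedCategory.

(* Main.v *)
Require Import Defs.
From Stdlib Require Import Setoid Morphisms.
From HB Require Import structures.
From mathcomp Require Import all_boot all_order all_algebra.
From mathcomp Require Import boolp classical_sets functions fsbigop.

(** Fix an injective coresolution E of C of finite length, and call a module
    ext-acyclic when Ext^j(-, C) vanishes on it for all j > 0.  Powers of C and
    projective modules are ext-acyclic, and since E is finite every sufficiently
    high syzygy is.  Covering a complex by contractible complexes of free
    modules and taking kernels until the syzygies become ext-acyclic yields, for
    every complex X, a surjective quasi-isomorphism Z -> X with all Z^i
    ext-acyclic ([ext_resolution]).

    For such a Z, vanishing of Hom(Z, Sigma^j C) in the derived category is
    exactness of the complex of groups Hom(Z^i, C) in degree -j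
    ([DHom_eq0_C_exact]).  One direction uses that bounded below complexes of
    injectives are K-injective, so that homotopy classes of maps into them are
    an invariant of formal composites of chain maps and inverses
    ([Deq0_homotopic0]); a homotopy into E is then corrected, from the top
    degree of E downwards, to one with values in C ([null_after_aug]).  The
    other direction writes every morphism as a right fraction
    ([right_fraction]).  Both subcategories of the t-structure thus become
    exactness conditions on Hom(Z, C), in complementary ranges of degrees.

    The truncation of Z is built by hand.  Put A^i = Z^i + L^i with L^i = 0 for
    i <= 1, and let L^(i+1) be the power of C indexed by all maps A^i -> C
    vanishing on boundaries, the differential being evaluation ([truncation]).
    Then Hom(A, C) is exact in degrees i >= 1, so A lies in D^{<= 0}.  The cone
    of the projection A -> Z is, up to a shift, L; it satisfies the vanishing
    that defines D^{>= 1} because L starts in degree 2.  This is the triangle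
    required by the third axiom.

    The projection A -> Z moreover has a lifting property: a chain map Z' -> Z
    with Z' in D^{<= 0} lifts to A strictly, one degree at a time, since the
    component of the lift on a factor C of L^(i+1) is the factorization of a
    cocycle on Z' through the differential.  If in addition Z lies in
    D^{>= 1}, then Hom(A, C) is exact in every degree.  As an injective
    cogenerator has a finite resolution by modules in Prod C, this forces A to
    be acyclic ([C_exact_acyclic]).  Hence every morphism from D^{<= 0} to
    D^{>= 1} factors through a zero object, which is the first axiom. *)

Set Implicit Arguments.
Unset Strict Implicit.
Unset Printing Implicit Defensive.
Import Order.TTheory GRing.Theory Num.Theory.
Local Open Scope ring_scope.

(** * Linear maps, submodules and extension of maps *)

Section Modules.
Variable R : pzRingType.
Implicit Types M N E : rmodType R.

Definition linear_of M N (f : M -> N) (lf : linear f) : {linear M -> N} :=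
  HB.pack f (GRing.isLinear.Build R^c M N *:%R f lf).

Section Biproduct.
Variables M N : rmodType R.
Local Notation MN := (M * N : rmodType R)%type.

Lemma fst_linear : linear ((fun p => p.1) : MN -> M). Proof. by []. Qed.
Lemma snd_linear : linear ((fun p => p.2) : MN -> N). Proof. by []. Qed.

Lemma inl_linear : linear ((fun x => (x, 0)) : M -> MN).
Proof. by move=> a x y; apply: injective_projections; rewrite //= scaler0 addr0. Qed.

Lemma inr_linear : linear ((fun y => (0, y)) : N -> MN).
Proof. by move=> a x y; apply: injective_projections; rewrite //= scaler0 addr0. Qed.

Definition fst_lin : {linear MN -> M} := linear_of fst_linear.
Definition snd_lin : {linear MN -> N} := linear_of snd_linear.
Definition inl_lin : {linear M -> MN} := linear_of inl_linear.
Definition inr_lin : {linear N -> MN} := linear_of inr_linear.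

Lemma biproduct_decomp (p : MN) : p = inl_lin p.1 + inr_lin p.2.
Proof. by apply: injective_projections; rewrite /= ?addr0 ?add0r. Qed.

Lemma pair_linear E (f : {linear E -> M}) (g : {linear E -> N}) :
  linear ((fun x => (f x, g x)) : E -> MN).
Proof. by move=> a x y; apply: injective_projections; rewrite /= linearP. Qed.

Definition pair_lin E (f : {linear E -> M}) (g : {linear E -> N}) :
  {linear E -> MN} := linear_of (pair_linear f g).

Lemma copair_linear E (f : {linear M -> E}) (g : {linear N -> E}) :
  linear ((fun p => f p.1 + g p.2) : MN -> E).
Proof. by move=> a p q /=; rewrite !linearP scalerDr addrACA. Qed.

Definition copair_lin E (f : {linear M -> E}) (g : {linear N -> E}) :
  {linear MN -> E} := linear_of (copair_linear f g).

End Biproduct.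

Section Powers.
Variables (I : Type) (C : rmodType R).

Lemma coord_linear (k : I) : linear (fun f : (I -> C : rmodType R) => f k : C).
Proof. by []. Qed.

Lemma tuple_linear M (f : I -> {linear M -> C}) :
  linear ((fun x k => f k x) : M -> (I -> C : rmodType R)).
Proof. by move=> a x y; apply/funext => k; rewrite linearP. Qed.

Definition coord_lin (k : I) : {linear (I -> C : rmodType R) -> C} :=
  linear_of (coord_linear k).

Definition tuple_lin M (f : I -> {linear M -> C}) :
  {linear M -> (I -> C : rmodType R)} := linear_of (tuple_linear f).

End Powers.

(** Submodules are bundled with their closure proofs, so that the subtype can
    be given its module structure once and for all. *)
Record submodule M : Type := Submodule {
  sub_mem :> M -> Prop;
  sub_mem0 : sub_mem 0;
  sub_memP : forall a x y, sub_mem x -> sub_mem y -> sub_mem (a *: x + y)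
}.

Section SubmoduleType.
Variables (M : rmodType R) (S : submodule M).

Definition sub_pred : {pred M} := fun x => `[< S x >].

Lemma sub_pred_closed : submod_closed sub_pred.
Proof.
split=> [|a x y]; rewrite !unfold_in; first exact/asboolP/sub_mem0.
by move=> /asboolP Sx /asboolP Sy; exact/asboolP/sub_memP.
Qed.

HB.instance Definition _ :=
  GRing.isSubmodClosed.Build R^c M sub_pred sub_pred_closed.

Record submod : Type := Submod { sub_val : M; _ : sub_pred sub_val }.

HB.instance Definition _ := [isSub for sub_val].
HB.instance Definition _ := [Choice of submod by <:].
HB.instance Definition _ := [SubChoice_isSubLmodule of submod by <:].

Definition sub_incl : {linear submod -> M} := linear_of (linearP (val : submod -> M)).

Lemma sub_incl_inj : injective sub_incl.
Proof. exact: val_inj. Qed.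

Lemma sub_inclP (x : submod) : S (sub_incl x).
Proof. by case: x => x /= /asboolP. Qed.

Lemma sub_incl_ex x : S x -> exists u, sub_incl u = x.
Proof. by move=> /asboolP Sx; exists (Submod Sx). Qed.

End SubmoduleType.

Definition submodT M (S : submodule M) : rmodType R := submod S.

End Modules.

Section ModuleTools.
Variable R : pzRingType.
Implicit Types M N E P : rmodType R.

Lemma lin_lift M N E (i : {linear M -> N}) (g : {linear E -> N}) :
  injective i -> (forall x, exists y, g x = i y) ->
  exists h : {linear E -> M}, forall x, g x = i (h x).
Proof.
move=> inji /choice[h hE].
have lh : linear h by move=> a x y; apply: inji; rewrite linearP -!hE linearP.
by exists (linear_of lh).
Qed.

(** The universal property of the cokernel, for a surjection p that is not
    presented as a quotient: any set-theoretic section of p gives the same map. *)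
Lemma lin_descend M N E (p : {linear M -> N}) (g : {linear M -> E}) :
  (forall y, exists x, y = p x) -> (forall x, p x = 0 -> g x = 0) ->
  exists h : {linear N -> E}, forall x, g x = h (p x).
Proof.
move=> /choice[s sE] kerg.
have gE x y : p x = p y -> g x = g y.
  by move=> pxy; apply/eqP; rewrite -subr_eq0 -linearB kerg ?linearB ?pxy ?subrr.
have lh : linear (g \o s).
  by move=> a x y /=; rewrite -linearP; apply: gE; rewrite linearP -!sE.
by exists (linear_of lh) => x /=; apply: gE; rewrite -sE.
Qed.

Definition ker_submodule M N (f : {linear M -> N}) : submodule M.
Proof.
exists (fun x => f x = 0); first exact: linear0.
by move=> a x y fx fy; rewrite linearP fx fy scaler0 addr0.
Defined.

Definition im_submodule M N (f : {linear M -> N}) : submodule N.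
Proof.
exists (fun y => exists x, y = f x); first by exists 0; rewrite linear0.
by move=> a y z [u ->] [v ->]; exists (a *: u + v); rewrite linearP.
Defined.

(** The usual form in which injectivity is used: f need not be injective, since
    g factors through the image of f, which embeds into N. *)
Lemma injective_extend M N E (f : {linear M -> N}) (g : {linear M -> E}) :
  injective_mod E -> (forall x, f x = 0 -> g x = 0) ->
  exists h : {linear N -> E}, forall x, g x = h (f x).
Proof.
move=> injE kerg.
have [f' f'E] : exists f' : {linear M -> submodT (im_submodule f)},
    forall x, f x = sub_incl _ (f' x).
  apply: lin_lift; first exact: sub_incl_inj.
  move=> x; have [u uE] : exists u, sub_incl (im_submodule f) u = f x.
    by apply: sub_incl_ex; exists x.
  by exists u.
have [||g' g'E] := @lin_descend _ _ _ f' g.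
- move=> y; have [x yE] := sub_inclP y; exists x; apply: sub_incl_inj.
  by rewrite -f'E.
- by move=> x f'x; apply: kerg; rewrite f'E f'x linear0.
have [h hE] := injE _ _ _ g' (@sub_incl_inj _ _ (im_submodule f)).
by exists h => x; rewrite g'E f'E hE.
Qed.

Definition projective_mod P : Prop :=
  forall M N (p : {linear M -> N}) (f : {linear P -> N}),
    (forall x, exists y, f x = p y) ->
    exists g : {linear P -> M}, forall x, f x = p (g x).

Lemma projective_prod P1 P2 : projective_mod P1 -> projective_mod P2 ->
  projective_mod (P1 * P2 : rmodType R)%type.
Proof.
move=> pP1 pP2 M N p f fp.
have [x|g1 g1E] := pP1 _ _ p (f \o inl_lin P1 P2); first exact: fp.
have [x|g2 g2E] := pP2 _ _ p (f \o inr_lin P1 P2); first exact: fp.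
exists (copair_lin g1 g2) => q /=.
by rewrite {1}(biproduct_decomp q) !linearD -g1E -g2E.
Qed.

(** ** Free modules *)

Section Free.
Variable T : choiceType.

Definition finsupp_submodule : submodule (T -> (R^c)^o).
Proof.
exists (fun f => exists s : seq T, forall t, t \notin s -> f t = 0).
  by exists [::].
move=> a f g [s fs] [r gr]; exists (s ++ r) => t.
rewrite mem_cat negb_or => /andP[/fs ft /gr gt].
have -> : (a *: f + g) t = a *: f t + g t by [].
by rewrite ft gt scaler0 addr0.
Defined.

Definition free_mod : rmodType R := submodT finsupp_submodule.

Definition free_coef (f : free_mod) : T -> R^c := sub_incl _ f.

Section Extension.
Variables (M : rmodType R) (e : T -> M).

Definition free_ext_fun (f : free_mod) : M :=
  \sum_(t \in [set t | free_coef f t != 0]) free_coef f t *: e t.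

Lemma free_ext_seq (f : free_mod) (s : seq T) :
  uniq s -> (forall t, t \notin s -> free_coef f t = 0) ->
  free_ext_fun f = \sum_(t <- s) free_coef f t *: e t.
Proof.
move=> us fs; apply: fsbig_fwiden => // t /=.
  by apply: contra_neqT => /fs.
by case=> _ /negP; rewrite negbK => /eqP ->; rewrite scale0r.
Qed.

Lemma free_ext_linear : linear free_ext_fun.
Proof.
move=> a f g.
have [s fs] := sub_inclP f; have [r gr] := sub_inclP g.
set u := undup (s ++ r).
have fu t : t \notin u -> free_coef f t = 0.
  by rewrite mem_undup mem_cat negb_or => /andP[/fs].
have gu t : t \notin u -> free_coef g t = 0.
  by rewrite mem_undup mem_cat negb_or => /andP[_ /gr].
have fgE t : free_coef (a *: f + g) t = a * free_coef f t + free_coef g t.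
  by rewrite /free_coef linearP.
rewrite !(@free_ext_seq _ u) ?undup_uniq //; last first.
  by move=> t tu; rewrite fgE fu ?gu // mulr0 addr0.
rewrite scaler_sumr -big_split; apply: eq_bigr => t _ /=.
by rewrite fgE scalerDl scalerA.
Qed.

Definition free_ext : {linear free_mod -> M} := linear_of free_ext_linear.

End Extension.

Definition delta_fun (t : T) : T -> (R^c)^o := fun u => (u == t)%:R.

Lemma delta_subproof (t : T) : finsupp_submodule (delta_fun t).
Proof. by exists [:: t] => u; rewrite inE /delta_fun => /negPf ->. Qed.

Definition free_gen (t : T) : free_mod :=
  Submod (introT (asboolP _) (delta_subproof t)).

Lemma free_ext_gen M (e : T -> M) t : free_ext e (free_gen t) = e t.
Proof.
rewrite /= (@free_ext_seq _ _ _ [:: t]) //.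
  by rewrite big_seq1 /free_coef /= /delta_fun eqxx scale1r.
by move=> u; rewrite inE /free_coef /= /delta_fun => /negPf ->.
Qed.

(** A linear map out of a free module is determined by the generators; this is
    what turns a lift on generators into a lift of the map. *)
Lemma free_ext_unique M (g : {linear free_mod -> M}) f :
  g f = free_ext (g \o free_gen) f.
Proof.
have [s fs] := sub_inclP f.
have fu t : t \notin undup s -> free_coef f t = 0 by rewrite mem_undup => /fs.
rewrite /= (@free_ext_seq _ _ _ (undup s)) ?undup_uniq //.
have {1}-> : f = \sum_(t <- undup s) free_coef f t *: free_gen t.
  apply: (@sub_incl_inj _ _ finsupp_submodule).
  apply/funext => u; rewrite -[LHS]/(free_coef f u).
  rewrite -[RHS]/(free_coef _ u).
  rewrite (big_morph (free_coef^~ u) (id1 := 0) (op1 := +%R)) //.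
  have -> : \sum_(t <- undup s) free_coef (free_coef f t *: free_gen t) u =
            \sum_(t <- undup s) free_coef f t * (u == t)%:R by [].
  have [us|us] := boolP (u \in undup s).
    rewrite (bigD1_seq u) ?undup_uniq //= eqxx mulr1 big1 ?addr0 // => t tu.
    by rewrite eq_sym (negPf tu) mulr0.
  rewrite fu // big_seq big1 // => t ts.
  by case: eqP us => [->|_ _]; rewrite ?ts // mulr0.
rewrite raddf_sum; apply: eq_bigr => t _; exact: linearZZ.
Qed.

Lemma free_projective : projective_mod free_mod.
Proof.
move=> M N p f fp.
have [e eE] := choice (fun t => fp (free_gen t)).
exists (free_ext e) => x.
rewrite free_ext_unique.
apply/esym/(etrans (free_ext_unique (p \o free_ext e : {linear _ -> _}) x)).
congr (free_ext _ x); apply/funext => t;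
exact: etrans (congr1 p (free_ext_gen e t)) (esym (eE t)).
Qed.

End Free.
End ModuleTools.

(** * Quotients and cogenerators *)

Section Quotients.
Variable R : pzRingType.
Variables (M : rmodType R) (S : submodule M).

Local Open Scope quotient_scope.

Definition quot_type := Quotient.quot (sub_pred S).
HB.instance Definition _ := GRing.Zmodule.on quot_type.

Definition quot_pi (x : M) : quot_type := \pi_(Quotient.quot (sub_pred S)) x.

Lemma quot_pi_eq x y : quot_pi x = quot_pi y <-> S (x - y).
Proof.
split=> [/eqP|Sxy]; first by rewrite -Quotient.idealrBE => /asboolP.
by apply/eqP; rewrite -Quotient.idealrBE; apply/asboolP.
Qed.

Lemma quot_piD : {morph quot_pi : x y / x + y}.
Proof. exact: raddfD. Qed.

Lemma quot_pi_surj u : exists x, u = quot_pi x.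
Proof. by exists (repr u); rewrite /quot_pi reprK. Qed.

Definition quot_scale (a : R^c) (u : quot_type) : quot_type :=
  quot_pi (a *: repr u).

Lemma quot_scaleE a x : quot_scale a (quot_pi x) = quot_pi (a *: x).
Proof.
apply/quot_pi_eq; rewrite -scalerBr -[_ *: _]addr0.
apply: sub_memP (sub_mem0 S); apply/quot_pi_eq.
by rewrite /quot_pi reprK.
Qed.

Lemma quot_scaleA a b u : quot_scale a (quot_scale b u) = quot_scale (a * b) u.
Proof. by have [x ->] := quot_pi_surj u; rewrite !quot_scaleE scalerA. Qed.

Lemma quot_scale1 : left_id 1 quot_scale.
Proof. by move=> u; have [x ->] := quot_pi_surj u; rewrite quot_scaleE scale1r. Qed.

Lemma quot_scaleDr : right_distributive quot_scale +%R.
Proof.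
move=> a u v; have [x ->] := quot_pi_surj u; have [y ->] := quot_pi_surj v.
by rewrite -quot_piD !quot_scaleE scalerDr quot_piD.
Qed.

Lemma quot_scaleDl u : {morph quot_scale^~ u : a b / a + b}.
Proof.
move=> a b; have [x ->] := quot_pi_surj u.
by rewrite !quot_scaleE scalerDl quot_piD.
Qed.

HB.instance Definition _ := GRing.Zmodule_isLmodule.Build R^c quot_type
  quot_scaleA quot_scale1 quot_scaleDr quot_scaleDl.

Lemma quot_pi_linear : linear quot_pi.
Proof. by move=> a x y; rewrite quot_piD -quot_scaleE. Qed.

(** A cogenerator separates maps, not elements.  Let K consist of the elements
    killed by every map to Q that kills S: then the projection K -> M / S and
    the zero map agree after every map to Q, so they are equal and K lies in S. *)
Lemma cogenerator_separates (Q : rmodType R) x : cogenerator_mod Q ->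
  (forall phi : {linear M -> Q}, (forall y, S y -> phi y = 0) -> phi x = 0) ->
  S x.
Proof.
move=> cogQ phix0.
pose kill (phi : {linear M -> Q}) := forall z, S z -> phi z = 0.
have K0 phi : kill phi -> phi 0 = 0 by move=> _; exact: linear0.
have KP a (y z : M) : (forall phi, kill phi -> phi y = 0) ->
    (forall phi, kill phi -> phi z = 0) ->
    forall phi, kill phi -> phi (a *: y + z) = 0.
  by move=> Ky Kz phi kphi; rewrite linearP Ky // Kz // scaler0 addr0.
pose K := Submodule K0 KP.
have [u ux] : exists u, sub_incl K u = x by apply/sub_incl_ex.
have/quot_pi_eq : quot_pi x = quot_pi 0; last by rewrite subr0.
pose pi := linear_of quot_pi_linear.
have pi0 z : S z -> pi z = 0.
  by move=> Sz; rewrite -(linear0 pi); apply/quot_pi_eq; rewrite subr0.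
have -> : quot_pi 0 = 0 by exact: (linear0 pi).
rewrite -ux.
apply: (cogQ _ _ (pi \o sub_incl K : {linear submodT K -> _})
         (\0 : {linear submodT K -> quot_type}) _ u).
move=> h v /=; rewrite linear0.
apply: (sub_inclP v (h \o pi : {linear M -> Q})) => z Sz /=.
by rewrite -[quot_pi z]/(pi z) pi0 // linear0.
Qed.
End Quotients.

(** * Vanishing of Ext *)

Section ShortExactSequences.
Variable R : pzRingType.
Implicit Types M N K P X : rmodType R.

Definition short_exact K P X (i : {linear K -> P}) (p : {linear P -> X}) : Prop :=
  [/\ injective i, exact_at i p & forall x, exists y, x = p y].

Lemma projective_presentation X : exists (K P : rmodType R) (i : {linear K -> P})
  (p : {linear P -> X}), projective_mod P /\ short_exact i p.
Proof.
pose p := free_ext (id : X -> X).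
exists (submodT (ker_submodule p)), (free_mod R X), (sub_incl _), p.
split; first exact: free_projective.
split; first exact: sub_incl_inj.
  move=> y; split=> [py|[x ->]]; last exact: (sub_inclP x).
  have [u uE] : exists u, sub_incl (ker_submodule p) u = y by exact: sub_incl_ex.
  by exists u.
by move=> x; exists (free_gen R x); rewrite /p free_ext_gen.
Qed.

Lemma in_Prod_retract C M : in_Prod C M -> exists (I : Type)
  (j : {linear M -> (I -> C : rmodType R)})
  (q : {linear (I -> C : rmodType R) -> M}), forall x, q (j x) = x.
Proof.
move=> [I [N [phi [psi phiK psiK]]]].
have lpsi : linear psi.
  by move=> a x y; apply: (can_inj phiK); rewrite linearP !psiK.
have lq : linear (fun f : (I -> C : rmodType R) => (psi f).1) by move=> a f g; rewrite lpsi.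
exists I, (phi \o inl_lin M N), (linear_of lq) => x /=.
by rewrite phiK.
Qed.

End ShortExactSequences.

Section Ext.
Variables (R : pzRingType) (C : rmodType R) (E : nat -> rmodType R).
Variables (eta : {linear C -> E 0%N}) (d : forall i, {linear E i -> E i.+1}).
Hypothesis coresE : inj_coresolution eta d.
Implicit Types M N K P X : rmodType R.

(** Ext^j(M, C) = 0 for all j > m, computed with the coresolution E.  The index
    shift k.+1 leaves out the group of homomorphisms. *)
Definition ext_vanish_above (m : nat) M : Prop :=
  forall k, (m <= k)%N -> Hom_cohomology_eq0 k.+1 M d.

Lemma ext_vanish_zero m M : is_zero_mod M -> ext_vanish_above m M.
Proof.
move=> M0 k _ g _; exists \0 => x.
by rewrite (M0 x) !linear0.
Qed.

Lemma ext_vanish_projective m P : projective_mod P -> ext_vanish_above m P.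
Proof.
case: coresE => _ _ _ exE pP k _ g dg; apply: pP => x.
by apply/exE/dg.
Qed.

Lemma ext_vanish_prod m M N : ext_vanish_above m M -> ext_vanish_above m N ->
  ext_vanish_above m (M * N : rmodType R)%type.
Proof.
move=> eM eN k mk g dg.
have [x|h1 h1E] := eM k mk (g \o inl_lin M N); first exact: dg.
have [x|h2 h2E] := eN k mk (g \o inr_lin M N); first exact: dg.
exists (copair_lin h1 h2) => q /=.
by rewrite {1}(biproduct_decomp q) !linearD -h1E -h2E.
Qed.

Section ShortExact.
Variables (K P X : rmodType R) (i : {linear K -> P}) (p : {linear P -> X}).
Hypothesis exact_ipP : short_exact i p.

Lemma short_exact_zero x : p (i x) = 0.
Proof. by case: exact_ipP => _ ex _; apply/ex; exists x. Qed.

Lemma short_exact_descend N (g : {linear P -> N}) :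
  (forall x, g (i x) = 0) -> exists h : {linear X -> N}, forall x, g x = h (p x).
Proof.
move=> gi; case: exact_ipP => _ ex surj; apply: lin_descend => // x /ex[y ->].
exact: gi.
Qed.

(** Dimension shifting with E fixed in the second variable: a cocycle on K
    extends to P, its coboundary descends to a cocycle on X one degree higher,
    and a primitive of the latter corrects the extension to a cocycle on P,
    which is a coboundary as P is projective. *)
Lemma ext_vanish_syzygy m :
  projective_mod P -> ext_vanish_above m.+1 X -> ext_vanish_above m K.
Proof.
case: coresE => injE _ _ exE pP eX k mk g dg.
case: (exact_ipP) => inji ex surj.
have [g' g'E] := injE _ _ _ _ g inji.
have [x|f fE] := short_exact_descend (g := d k.+1 \o g' : {linear P -> _}).
  by rewrite /= g'E dg.
have [x|t tE] := eX k.+1 mk f.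
  by have [y ->] := surj x; rewrite -fE /=; apply/exE; exists (g' y).
have [x|s sE] := pP _ _ (d k) (g' \- (t \o p : {linear P -> _})).
  apply/exE; rewrite /= linearB /=.
  by rewrite -(tE (p x)) -fE subrr.
exists (s \o i : {linear K -> _}) => x /=.
by rewrite -sE /= g'E short_exact_zero linear0 subr0.
Qed.

(** Vanishing of Ext^1(X, C), in the form of extension along K -> P: the
    obstruction to pushing an extension with values in E^0 into C is a cocycle
    on X. *)
Lemma extend_to_C (f : {linear K -> C}) : ext_vanish_above 0 X ->
  exists h : {linear P -> C}, forall x, f x = h (i x).
Proof.
case: coresE => injE inj_eta ex0 exE eX; case: (exact_ipP) => inji ex surj.
have [e eE] := injE 0%N _ _ _ (eta \o f : {linear K -> _}) inji.
have [x|g gE] := short_exact_descend (g := d 0 \o e : {linear P -> _}).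
  by rewrite /= eE; apply/ex0; exists (f x).
have [x|t tE] := eX 0%N isT g.
  by have [y ->] := surj x; rewrite -gE /=; apply/exE; exists (e y).
have [|h hE] := lin_lift (i := eta) (g := e \- (t \o p : {linear P -> _})) inj_eta.
  by move=> x; apply/ex0; rewrite /= linearB /= -(tE (p x)) -gE subrr.
exists h => x; apply: inj_eta.
by rewrite -hE /= eE short_exact_zero linear0 subr0.
Qed.

End ShortExact.

Lemma extend_to_Prod K P X (i : {linear K -> P}) (p : {linear P -> X}) M
    (f : {linear K -> M}) : short_exact i p -> in_Prod C M ->
  ext_vanish_above 0 X -> exists h : {linear P -> M}, forall x, f x = h (i x).
Proof.
move=> ip /in_Prod_retract[I [j [q qj]]] eX.
have /choice[h hE] k : exists h : {linear P -> C}, forall x, j (f x) k = h (i x).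
  exact: (extend_to_C ip (coord_lin C k \o (j \o f) : {linear K -> C}) eX).
exists (q \o tuple_lin h : {linear P -> M}) => x /=.
by rewrite -[LHS]qj; congr (q _); apply/funext => k; rewrite hE.
Qed.

(** An ext-acyclic X behaves like a projective module for a finite exact
    sequence with terms in Prod C.  On a projective P covering X the lift
    exists; on the syzygy K it takes values in the cycles of the next term, so by
    induction it comes from Cs k.+2, and extending that map to P gives the
    correction needed to descend to X. *)
Lemma lift_through_Prod_resolution (r : nat) (Cs : nat -> rmodType R)
    (dC : forall k, {linear Cs k.+1 -> Cs k}) :
  (forall k, (0 < k <= r)%N -> in_Prod C (Cs k)) ->
  (forall k, (r < k)%N -> is_zero_mod (Cs k)) ->
  (forall k, exact_at (dC k.+1) (dC k)) ->
  forall k (Y : rmodType R) (e : {linear Cs k -> Y}) X (f : {linear X -> Cs k}),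
  exact_at (dC k) e ->
  ext_vanish_above 0 X -> (forall x, e (f x) = 0) ->
  exists h : {linear X -> Cs k.+1}, forall x, f x = dC k (h x).
Proof.
move=> ProdC zeroC exC k.
(* The induction starts beyond r, where all terms vanish. *)
have [m] := ubnP (r.+1 - k); elim: m k => // m IHm k le_m Y e X f exe eX ef.
have [kr|rk] := leqP k r; last first.
  by exists \0 => x; rewrite (zeroC _ rk (f x)); exact: esym (linear0 _).
have [K [P [i [p [pP ip]]]]] := projective_presentation X.
have [x|g gE] := pP _ _ (dC k) (f \o p : {linear P -> _}); first exact/exe/ef.
have eK : ext_vanish_above 0 K.
  by apply: (ext_vanish_syzygy ip pP) => l _; apply: eX.
have [|x|s sE] := IHm k.+1 _ _ (dC k) _ (g \o i : {linear K -> _}) (exC k) eK.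
- by rewrite subSS; move: le_m; rewrite subSn // !ltnS.
- by rewrite /= -gE /= (short_exact_zero ip) linear0.
have [h hE] : exists h : {linear P -> Cs k.+2}, forall x,
    dC k.+1 (s x) = dC k.+1 (h (i x)).
  have [k1r|rk1] := leqP k.+2 r.
    by have [h hE] := extend_to_Prod s ip (ProdC k.+2 k1r) eX; exists h => x; rewrite hE.
  by exists \0 => x; rewrite (zeroC _ rk1 (s x)).
have [x|t tE] := short_exact_descend ip (g := g \- (dC k.+1 \o h : {linear P -> _})).
  by rewrite /= -hE -sE subrr.
exists t => x; case: (ip) => _ _ /(_ x)[y ->].
rewrite -tE /= linearB -gE /=.
have -> : dC k (dC k.+1 (h y)) = 0 by apply/exC; exists (h y).
by rewrite subr0.
Qed.

End Ext.

(** * Families indexed by the integers *)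

Section IntFamilies.
Variable T : int -> Type.

Definition cast (i j : int) (e : i = j) : T i -> T j :=
  match e in _ = k return T i -> T k with erefl => id end.

Lemma cast_id i (e : i = i) x : cast e x = x.
Proof. by rewrite (eq_irrelevance e erefl). Qed.

Lemma cast_cast i j k (e : i = j) (e' : j = k) x :
  cast e' (cast e x) = cast (etrans e e') x.
Proof. by case: k / e'; case: j / e. Qed.

(** Homotopies into a shifted complex come as families indexed by i + 1, and are
    read as families indexed by all integers. *)
Lemma int_reindex (f : forall i, T (i + 1)) : exists g : forall i, T i,
  forall i, g (i + 1) = f i.
Proof.
exists (fun i => cast (subrK 1 i) (f (i - 1))) => i.
have gen j (e : j = i) (e' : j + 1 = i + 1) : cast e' (f j) = f i.
  by case: i / e e' => e'; rewrite cast_id.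
exact/gen/addrK.
Qed.

(** Degreewise construction of a map or of a complex: a family prescribed up to
    degree a is continued upwards, each term being related to the next. *)
Lemma int_dependent_choice (rel : forall i, T i -> T (i + 1) -> Prop)
    (a : int) (t0 : forall i, T i) :
    (forall i, i < a -> rel i (t0 i) (t0 (i + 1))) ->
    (forall i, a <= i -> forall x : T i, exists y, rel i x y) ->
  exists2 f : forall i, T i, forall i, i <= a -> f i = t0 i
    & forall i, rel i (f i) (f (i + 1)).
Proof.
move=> rel0 step.
have nextP (p : {i : int & T i}) : exists y : T (projT1 p + 1),
    a <= projT1 p -> rel _ (projT2 p) y.
  have [ap|pa] := pselect (a <= projT1 p); last by exists (t0 _).
  by have [y yP] := step _ ap (projT2 p); exists y.
pose nx i x := sval (cid (nextP (existT T i x))).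
have e0 : a = a + 0%N%:Z by rewrite addr0.
have eS k : a + k%:Z + 1 = a + k.+1%:Z by rewrite -addrA -(PoszD k 1) addn1.
pose s := fix s k : T (a + k%:Z) :=
  if k is k'.+1 then cast (eS k') (nx _ (s k')) else cast e0 (t0 a).
have pos i : ~ (i <= a) -> a + `|i - a|%N%:Z = i.
  move=> /negP; rewrite -ltNge => ai.
  by rewrite gez0_abs ?subr_ge0 ?ltW // addrCA subrr addr0.
pose f i : T i := match pselect (i <= a) with
  | left _ => t0 i | right n => cast (pos i n) (s _) end.
have fE k i (e : a + k%:Z = i) : f i = cast e (s k).
  rewrite /f; case: pselect => [ia|nia].
    case: k e => [|k] e /=; last first.
      by exfalso; move: ia; rewrite -e gerDl lez_nat.
    rewrite cast_cast; move: (etrans _ _) => e'; case: i / e' ia {e} => //.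
  move: (pos i nia); move: (`|_|%N) => l el.
  have kl : k = l by move: (etrans e (esym el)) => /addrI [].
  by subst l; congr (cast _ _); exact: eq_irrelevance.
have f0 i : i <= a -> f i = t0 i by rewrite /f; case: pselect.
exists f => // i; have [ia|ai] := ltP i a.
  by rewrite !f0 ?lezD1 ?ltW //; exact: rel0.
have [k e] : exists k : nat, a + k%:Z = i.
  by exists `|i - a|%N; rewrite gez0_abs ?subr_ge0 // addrCA subrr addr0.
case: i / e ai => ai.
rewrite (fE k _ erefl) (fE k.+1 _ (esym (eS k))) /= cast_cast cast_id.
exact: svalP (cid (nextP (existT T _ (s k)))) ai.
Qed.

Lemma int_dependent_choice_inv (inv : forall i, T i -> Prop)
    (rel : forall i, T i -> T (i + 1) -> Prop) (a : int) (t0 : forall i, T i) :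
    (forall i, i <= a -> inv i (t0 i)) ->
    (forall i, i < a -> rel i (t0 i) (t0 (i + 1))) ->
    (forall i, a <= i -> forall x : T i, inv i x ->
       exists2 y, inv (i + 1) y & rel i x y) ->
  exists2 f : forall i, T i, forall i, inv i (f i)
    & forall i, rel i (f i) (f (i + 1)).
Proof.
move=> inv0 rel0 step.
have [||f f0 frel] := @int_dependent_choice
    (fun i x y => inv i x -> inv (i + 1) y /\ rel i x y) a t0.
- by move=> i ia _; split; [apply: inv0; rewrite lezD1 | apply: rel0].
- move=> i ai x; have [ix|nix] := pselect (inv i x); last by exists (t0 _).
  by have [y iy xy] := step i ai x ix; exists y.
have invf i : inv i (f i).
  have [ia|ai] := leP i a; first by rewrite f0 //; exact: inv0.
  have [k <-] : exists k : nat, a + k%:Z = i.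
    by exists `|i - a|%N; rewrite gez0_abs ?subr_ge0 ?ltW // addrCA subrr addr0.
  elim: k => [|k IHk]; first by rewrite addr0 f0 //; exact: inv0.
  by rewrite -addn1 PoszD addrA; exact: (frel _ IHk).1.
by exists f => // i; exact: (frel i (invf i)).2.
Qed.

End IntFamilies.

(** * Morphisms of the derived category *)

#[local] Hint Extern 0 (Deq _ _) => apply: Deq_refl : core.

Section Derived.
Variable R : pzRingType.
Implicit Types X Y Z N J : complex R.

#[global] Instance Deq_equivalence X Y : Equivalence (@Deq R X Y).
Proof. split; [exact: Deq_refl | exact: Deq_sym | exact: Deq_trans]. Qed.

#[global] Instance Dcomp_proper X Y Z :
  Proper (@Deq R Y Z ==> @Deq R X Y ==> @Deq R X Z) (@Dcomp R X Y Z).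
Proof. by move=> v v' vv' u u' uu'; apply: Deq_comp. Qed.

Definition acyclic N : Prop :=
  forall (i : int) (x : N (i + 1)), diff N (i + 1) x = 0 ->
    exists y, x = diff N i y.

Definition homotopic X Y (f g : chain_map X Y) : Prop :=
  exists h : forall i, {linear X (i + 1) -> Y i}, forall i x,
    f (i + 1) x - g (i + 1) x = h (i + 1) (diff X (i + 1) x) + diff Y i (h i x).

Lemma homotopic_ext X Y (f g : chain_map X Y) :
  (forall i x, f i x = g i x) -> homotopic f g.
Proof.
move=> fg; exists (fun i => \0) => i x.
by rewrite fg subrr; exact: esym (etrans (add0r _) (linear0 (diff Y i))).
Qed.

Lemma homotopic_sym X Y (f g : chain_map X Y) : homotopic f g -> homotopic g f.
Proof.
move=> [h hE]; exists (fun i => \- h i) => i x.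
by rewrite -opprB hE /= linearN opprD.
Qed.

Lemma homotopic_trans X Y (f g k : chain_map X Y) :
  homotopic f g -> homotopic g k -> homotopic f k.
Proof.
move=> [h hE] [h' hE']; exists (fun i => h i \+ h' i) => i x.
by rewrite -(subrKA (g (i + 1) x)) hE hE' /= linearD addrACA.
Qed.

Lemma homotopic_precomp X Y Z (f g : chain_map Y Z) (k : chain_map X Y) :
  homotopic f g -> homotopic (comp_map f k) (comp_map g k).
Proof.
move=> [h hE]; exists (fun i => h i \o k (i + 1)) => i x.
by rewrite /= hE comm_diff.
Qed.

(** The long exact sequence of the cone, on elements. *)
Lemma cone_acyclic X Y (s : chain_map X Y) : quasi_iso s -> acyclic (cone s).
Proof.
move=> qs i [x y] [/eqP]; rewrite oppr_eq0 => /eqP dx dy.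
have [x' xE] : exists x', x = diff X (i + 1) x'.
  apply: (qs (i + 1)).1 => //; exists (- y).
  by rewrite linearN; apply/eqP; rewrite -addr_eq0; apply/eqP.
have [|x'' [dx'' [y' y'E]]] := (qs i).2 (y + s (i + 1) x').
  by rewrite linearD comm_diff -xE [LHS]addrC.
exists (x'' - x', y'); apply: injective_projections => /=.
  by rewrite linearB dx'' sub0r opprK.
by rewrite -y'E linearB [RHS]addrC subrKA addrK.
Qed.

Lemma zero_quasi_iso N : acyclic N -> quasi_iso (zero_map N N).
Proof.
move=> aN i; split=> [x dx _|y dy]; first exact: aN.
exists 0; rewrite linear0; split=> //.
by have [y' ->] := aN i y dy; exists y'; rewrite /= subr0.
Qed.

Lemma Dloc_comp0 X Y Z (f : chain_map Y Z) :
  Deq (Dcomp (Dloc f) (Dloc (zero_map X Y))) (Dloc (zero_map X Z)).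
Proof. by rewrite -Deq_loc_comp; apply: Deq_loc_ext => i x /=; exact: linear0. Qed.

Lemma Dloc_0comp X Y Z (f : chain_map X Y) :
  Deq (Dcomp (Dloc (zero_map Y Z)) (Dloc f)) (Dloc (zero_map X Z)).
Proof. by rewrite -Deq_loc_comp; apply: Deq_loc_ext. Qed.

Lemma Dinv_cancelr X Y Z (s : chain_map X Y) (qs : quasi_iso s) (u v : Dmor Y Z) :
  Deq (Dcomp u (Dloc s)) (Dcomp v (Dloc s)) -> Deq u v.
Proof.
move=> uv; rewrite -(Deq_idr u) -(Deq_idr v) -(Deq_invr qs).
by rewrite !Deq_assoc uv.
Qed.

Lemma Dinv_cancell X Y Z (s : chain_map Y Z) (qs : quasi_iso s) (u v : Dmor X Y) :
  Deq (Dcomp (Dloc s) u) (Dcomp (Dloc s) v) -> Deq u v.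
Proof.
move=> uv; rewrite -(Deq_idl u) -(Deq_idl v) -(Deq_invl qs).
by rewrite -!Deq_assoc uv.
Qed.

(** The zero endomorphism of an acyclic complex is a quasi-isomorphism, hence
    invertible; being idempotent it is the identity. *)
Lemma acyclic_id0 N : acyclic N -> Deq (Dloc (id_map N)) (Dloc (zero_map N N)).
Proof.
move=> /zero_quasi_iso q0; apply: (Dinv_cancelr (s := zero_map N N) q0).
by rewrite Deq_idl Dloc_0comp.
Qed.

Lemma acyclic_factor0 X N Y (g : chain_map N Y) (f : chain_map X N) :
  acyclic N -> Deq (Dloc (comp_map g f)) (Dloc (zero_map X Y)).
Proof.
move=> /acyclic_id0 N0; rewrite Deq_loc_comp -(Deq_idl (Dloc f)) N0.
by rewrite Dloc_0comp Dloc_comp0.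
Qed.

Lemma id_quasi_iso X : quasi_iso (id_map X).
Proof.
move=> i; split=> [x _ [y xy]|y dy]; first by exists y.
by exists y; split=> //; exists 0; rewrite subrr linear0.
Qed.

Lemma comp_quasi_iso X Y Z (g : chain_map Y Z) (f : chain_map X Y) :
  quasi_iso g -> quasi_iso f -> quasi_iso (comp_map g f).
Proof.
move=> qg qf i; split=> [x dx gfx|z dz].
  by apply: (qf i).1 => //; apply: (qg i).1 => //; rewrite comm_diff dx linear0.
have [y [dy [z' z'E]]] := (qg i).2 z dz.
have [x [dx [y' y'E]]] := (qf i).2 y dy.
exists x; split=> //; exists (z' + g i y').
by rewrite linearD -z'E comm_diff -y'E linearB addrA subrK.
Qed.

(** A nullhomotopy is an extension of f to the cone of the identity of its
    source, which is acyclic. *)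
Lemma homotopic0_Deq X Y (f : chain_map X Y) :
  homotopic f (zero_map X Y) -> Deq (Dloc f) (Dloc (zero_map X Y)).
Proof.
move=> [h hE].
pose k i : {linear cone (id_map X) i -> Y i} := copair_lin (h i) (f i).
have kC i (p : cone (id_map X) i) : diff Y i (k i p)
    = k (i + 1) (diff (cone (id_map X)) i p).
  case: p => x y; have := hE i x; rewrite /= subr0 linearD comm_diff => fx.
  by rewrite linearN linearD fx addrA addrA addNr add0r.
have -> : Deq (Dloc f) (Dloc (comp_map (ChainMap kC) (cone_in (id_map X)))).
  by apply: Deq_loc_ext => i x; rewrite /= linear0 add0r.
by apply: acyclic_factor0; apply/cone_acyclic/id_quasi_iso.
Qed.

End Derived.

(** * K-injective complexes *)

Section KInjective.
Variable R : pzRingType.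
Implicit Types X Y Z N J : complex R.

Definition K_injective J : Prop :=
  forall N (f : chain_map N J), acyclic N -> homotopic f (zero_map N J).

(** A nullhomotopy is built upwards from degree a.  The condition inv i says that
    f (i + 1) - d h i vanishes on boundaries, that is on cycles as N is acyclic;
    this is what allows the next component to be obtained by injectivity. *)
Lemma bounded_below_K_injective J (a : int) :
  (forall i, injective_mod (J i)) -> (forall i, i < a -> is_zero_mod (J i)) ->
  K_injective J.
Proof.
move=> injJ J0 N f aN.
pose inv i (h : {linear N (i + 1) -> J i}) :=
  forall x, diff J i (f i x) = diff J i (h (diff N i x)).
pose rel i (h : {linear N (i + 1) -> J i}) (h' : {linear N (i + 1 + 1) -> J (i + 1)})
  := forall x, f (i + 1) x = h' (diff N (i + 1) x) + diff J i (h x).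
have [||i _ h invh|h _ hE] :=
    @int_dependent_choice_inv _ inv rel (a - 1) (fun i => \0).
- move=> i ia x; congr (diff J i _); apply: etrans (J0 i _ _) _ => //.
  by rewrite -(subrK 1 a) ltzD1.
- move=> i ia x.
  by rewrite [LHS](J0 (i + 1) _) ?[RHS](J0 (i + 1) _) // -ltrBrDr.
- have [x dx|h' h'E] := injective_extend
      (f := diff N (i + 1)) (g := f (i + 1) \- (diff J i \o h : {linear _ -> _}))
      (injJ (i + 1)).
    have [y ->] := aN i x dx.
    by rewrite /= -comm_diff -invh subrr.
  have h'rel : rel i h h' by move=> x; rewrite -h'E /= subrK.
  exists h' => // x; rewrite h'rel linearD diffK addr0.
  by congr (diff J _ _).
by exists h => i x; exact: etrans (subr0 _) (hE i x).
Qed.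

(** Homotopy classes of maps to a K-injective complex J form a contravariant
    functor inverting quasi-isomorphisms.  Injectivity on classes uses maps from
    the cone to J; surjectivity uses maps from the cone to Sigma J, whence the
    hypothesis on the shift. *)
Section Cohomology.
Variables (J : complex R).
Hypotheses (injJ : K_injective J) (injSJ : K_injective (shift 1 J)).

Lemma K_injective_qis_inj X Y (s : chain_map X Y) (g g' : chain_map Y J) :
  quasi_iso s -> homotopic (comp_map g s) (comp_map g' s) -> homotopic g g'.
Proof.
move=> qs [h hE].
pose G i : {linear cone s i -> J i} := copair_lin (h i) (g i \- g' i).
have GC i (p : cone s i) : diff J i (G i p) = G (i + 1) (diff (cone s) i p).
  case: p => x y; have := hE i x; rewrite /= (linearD (diff J i)) (linearB (diff J i)).
  rewrite !comm_diff (linearN (h _)) (linearD (g _)) (linearD (g' _)) => gs.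
  by rewrite opprD addrACA gs !addrA addNr add0r.
have [H HE] := injJ (ChainMap GC) (cone_acyclic qs).
exists (fun i => H i \o cone_in s (i + 1)) => i y.
have := HE i (cone_in s (i + 1) y).
by rewrite (comm_diff (cone_in s)) /= linear0 add0r subr0.
Qed.

Lemma shift1_diff X i (x : X (i + 1)) :
  diff (shift 1 X) i x = - diff X (i + 1) x.
Proof.
rewrite /= /shift_diff /sign_lin /=.
by rewrite (eq_irrelevance (shift_index 1 i) erefl).
Qed.

Lemma K_injective_qis_surj X Y (s : chain_map X Y) (f : chain_map X J) :
  quasi_iso s -> exists g : chain_map Y J, homotopic (comp_map g s) f.
Proof.
move=> qs.
have [H HE] := injSJ (comp_map (shift_map 1 f) (cone_out s)) (cone_acyclic qs).
have {}HE i x y : f (i + 1 + 1) x =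
    H (i + 1) (- diff X (i + 1 + 1) x, s (i + 1 + 1) x + diff Y (i + 1) y)
    - diff J (i + 1) (H i (x, y)).
  by have := HE i (x, y); rewrite shift1_diff /= => <-; rewrite subr0.
have [g gE] := @int_reindex (fun i => {linear Y i -> J i})
  (fun i => H i \o inr_lin _ _ : {linear Y (i + 1) -> J (i + 1)}).
have [k kE] := @int_reindex (fun i => {linear X (i + 1) -> J i})
  (fun i => H i \o inl_lin _ _ : {linear X (i + 1 + 1) -> J (i + 1)}).
have gC m y : diff J m (g m y) = g (m + 1) (diff Y m y).
  move: (m - 1) (subrK 1 m) y => i e; case: m / e => y.
  rewrite !gE /=; apply/eqP; rewrite eq_sym -subr_eq0.
  by have := HE i 0 y; rewrite (linear0 (f _)) (linear0 (diff X _)) (linear0 (s _)) oppr0 add0r => <-.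
exists (ChainMap gC), k => m x.
move: (m - 1) (subrK 1 m) x => i e; case: m / e => x.
rewrite /= !kE gE /=.
have -> : f (i + 1 + 1) x =
    H (i + 1) (- diff X (i + 1 + 1) x, s (i + 1 + 1) x) - diff J (i + 1) (H i (x, 0)).
  by have := HE i x 0; rewrite linear0 addr0.
rewrite opprB addrCA [RHS]addrC; congr (_ + _); rewrite -linearB; congr (H _ _).
by apply: injective_projections; rewrite /= ?sub0r ?opprK ?subrr.
Qed.

(** The action of a formal composite on homotopy classes of maps to J, as a
    relation: an inverse formally acts by the inverse of composition. *)
Fixpoint pull X Y (u : Dmor X Y) : chain_map Y J -> chain_map X J -> Prop :=
  match u in Dmor X Y return chain_map Y J -> chain_map X J -> Prop with
  | Dloc _ _ f => fun g k => homotopic (comp_map g f) k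
  | Dinv _ _ s _ => fun g k => homotopic (comp_map k s) g
  | Dcomp _ _ _ v u => fun g k => exists l, pull v g l /\ pull u l k
  end.

Lemma pull_homotopic X Y (u : Dmor X Y) g g' k k' :
  homotopic g g' -> homotopic k k' -> pull u g k -> pull u g' k'.
Proof.
elim: u g g' k k' => {X Y} [X Y f|X Y s qs|X Y Z v IHv u IHu] g g' k k' gg kk /=.
- move=> gk; apply: homotopic_trans (homotopic_trans gk kk).
  exact/homotopic_precomp/homotopic_sym.
- move=> ks; apply: homotopic_trans (homotopic_trans ks gg).
  exact/homotopic_precomp/homotopic_sym.
- by move=> [l [vl ul]]; exists l; split; [apply: IHv vl | apply: IHu ul] => //;
     exact: homotopic_ext.
Qed.

(** The relations of the derived category hold for the action.  The two inverse
    laws are the bijectivity of composition with a quasi-isomorphism. *)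
Lemma pull_Deq X Y (u v : Dmor X Y) :
  Deq u v -> forall g k, pull u g k <-> pull v g k.
Proof.
have refl (Z W : complex R) (f : chain_map Z W) : homotopic f f by exact: homotopic_ext.
elim=> {X Y u v} /=.
- by [].
- by move=> X Y u v _ uv g k; rewrite uv.
- by move=> X Y u v w _ uv _ vw g k; rewrite uv vw.
- by move=> X Y Z v v' u u' _ vv _ uu g k; split=> -[l [vl ul]]; exists l;
     (split; [apply/vv | apply/uu]).
- move=> X Y Z W w v u g k; split.
    by move=> [l [wl [m [vm um]]]]; exists m; split=> //; exists l.
  by move=> [l [[m [wm vl]] ul]]; exists m; split=> //; exists l.
- move=> X Y u g k; split=> [[l [gl ul]]|uk].
    apply: (pull_homotopic _ (refl _ _ k) ul); apply: homotopic_sym.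
    by apply: homotopic_trans gl; exact: homotopic_ext.
  by exists g; split=> //; exact: homotopic_ext.
- move=> X Y u g k; split=> [[l [ul lk]]|uk].
    apply: (pull_homotopic (refl _ _ g) _ ul).
    by apply: homotopic_trans lk; exact: homotopic_ext.
  by exists k; split=> //; exact: homotopic_ext.
- move=> X Y f f' ff g k; split=> h; apply: homotopic_trans h;
  by apply: homotopic_ext => i x; rewrite /= ff.
- move=> X Y Z f' f g k; split=> [gk|[l [gl lk]]].
    by exists (comp_map g f'); split.
  by apply: homotopic_trans lk; apply: homotopic_trans (homotopic_precomp f gl);
     exact: homotopic_ext.
- move=> X Y s qs g k; split=> [[l [lg gk]]|gk].
    apply: homotopic_trans gk; apply: homotopic_trans (homotopic_sym lg).
    exact: homotopic_ext.
  have [l lg] := K_injective_qis_surj g qs; exists l; split=> //.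
  by apply: homotopic_trans lg (homotopic_trans _ gk); exact: homotopic_ext.
- move=> X Y s qs g k; split=> [[l [gl kl]]|gk].
    apply: (homotopic_trans (g := g)); first exact: homotopic_ext.
    by apply: (K_injective_qis_inj qs); apply: homotopic_trans gl (homotopic_sym _).
  exists (comp_map g s); split=> //; apply/homotopic_sym/homotopic_precomp.
  by apply: homotopic_trans gk; exact: homotopic_ext.
Qed.

(** Maps to J that agree in the derived category are homotopic: compare the
    actions on the identity of J. *)
Lemma Deq0_homotopic0 X (f : chain_map X J) :
  Deq (Dloc f) (Dloc (zero_map X J)) -> homotopic f (zero_map X J).
Proof.
move=> /pull_Deq/(_ (id_map J) f)[+ _] => /(_ _)[|h hE]; first exact: homotopic_ext.
by apply: homotopic_sym; exists h.
Qed.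
End Cohomology.
End KInjective.

(** * Resolutions by complexes with vanishing Ext *)

Section ComplexTools.
Variable R : pzRingType.
Implicit Types X Y Z K P W : complex R.

Definition surjective X Y (f : chain_map X Y) : Prop :=
  forall i y, exists x, y = f i x.

Definition short_exact_cpx K P X (i : chain_map K P) (p : chain_map P X) : Prop :=
  forall n, short_exact (i n) (p n).

Section Kernel.
Variables (X Y : complex R) (f : chain_map X Y).

Definition ker_ob (i : int) : rmodType R := submodT (ker_submodule (f i)).

Lemma ker_diff_subproof i (x : ker_ob i) :
  ker_submodule (f (i + 1)) (diff X i (sub_incl _ x)).
Proof.
rewrite /= -comm_diff.
by have /= -> := sub_inclP x; rewrite linear0.
Qed.

Definition ker_diff_fun i (x : ker_ob i) : ker_ob (i + 1) :=
  Submod (introT (asboolP _) (ker_diff_subproof x)).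

Lemma ker_diff_linear i : linear (@ker_diff_fun i).
Proof.
move=> a x y; apply: (@sub_incl_inj _ _ (ker_submodule (f (i + 1)))).
by rewrite linearP /= -linearP; congr (diff X i _); exact: linearP.
Qed.

Lemma ker_diffK i (x : ker_ob i) :
  linear_of (@ker_diff_linear (i + 1)) (linear_of (@ker_diff_linear i) x) = 0.
Proof.
apply: (@sub_incl_inj _ _ (ker_submodule (f (i + 1 + 1)))).
by rewrite linear0 /= diffK.
Qed.

Definition ker_complex : complex R :=
  @Complex R ker_ob (fun i => linear_of (@ker_diff_linear i)) ker_diffK.

Definition ker_incl : chain_map ker_complex X :=
  @ChainMap R ker_complex X (fun i => sub_incl (ker_submodule (f i)))
    (fun i x => erefl).

Lemma ker_incl_ex i (x : X i) : f i x = 0 -> exists u, ker_incl i u = x.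
Proof. by move=> fx; exact: (sub_incl_ex (S := ker_submodule (f i))). Qed.

Lemma ker_short_exact : surjective f -> short_exact_cpx ker_incl f.
Proof.
move=> surj n; split; [exact: sub_incl_inj | | exact: surj].
move=> y; split=> [/ker_incl_ex[x <-]|[x ->]]; first by exists x.
exact: (sub_inclP (x : submodT (ker_submodule (f n)))).
Qed.

End Kernel.

Section Product.
Variables (X Y : complex R).

Definition prod_diff i :
    {linear (X i * Y i)%type -> (X (i + 1)%R * Y (i + 1)%R)%type} :=
  pair_lin (diff X i \o fst_lin _ _) (diff Y i \o snd_lin _ _).

Lemma prod_diffK i (p : (X i * Y i)%type) :
  @prod_diff (i + 1) (@prod_diff i p) = 0.
Proof. by apply: injective_projections; rewrite /= diffK. Qed.

Definition prod_complex : complex R :=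
  @Complex R (fun i => (X i * Y i)%type) prod_diff prod_diffK.

Definition prod_fst : chain_map prod_complex X :=
  @ChainMap R prod_complex X (fun i => fst_lin (X i) (Y i)) (fun i x => erefl).
Definition prod_snd : chain_map prod_complex Y :=
  @ChainMap R prod_complex Y (fun i => snd_lin (X i) (Y i)) (fun i x => erefl).

End Product.

Section Copair.
Variables (X Y Z : complex R) (f : chain_map X Z) (g : chain_map Y Z).

Definition copair_ob i : {linear prod_complex X Y i -> Z i} :=
  copair_lin (f i) (g i).

Lemma copair_comm i (p : prod_complex X Y i) :
  diff Z i (copair_ob i p) = copair_ob (i + 1) (diff (prod_complex X Y) i p).
Proof. by rewrite /= linearD !comm_diff. Qed.

Definition copair : chain_map (prod_complex X Y) Z := ChainMap copair_comm.
End Copair.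

(** Given an exact sequence K -> P -> X and a quasi-isomorphism K' -> K, the
    cone of the composite K' -> P is quasi-isomorphic to X.  This splices a
    resolution of the kernel K into one of X. *)
Section ConeOverExact.
Variables (K' K P X : complex R) (s : chain_map K' K).
Variables (i : chain_map K P) (p : chain_map P X).
Hypotheses (qs : quasi_iso s) (exact_ip : short_exact_cpx i p).

Definition cone_to_ob n : {linear cone (comp_map i s) n -> X n} :=
  p n \o snd_lin _ _.

Lemma cone_to_comm n (q : cone (comp_map i s) n) :
  diff X n (cone_to_ob n q) = cone_to_ob (n + 1) (diff (cone (comp_map i s)) n q).
Proof.
by rewrite /= linearD comm_diff (short_exact_zero (exact_ip _)) add0r.
Qed.

Definition cone_to : chain_map (cone (comp_map i s)) X := ChainMap cone_to_comm.

Lemma cone_to_surjective : surjective cone_to.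
Proof.
move=> n x; case: (exact_ip n) => _ _ /(_ x)[y ->].
by exists (0, y).
Qed.

Lemma cone_to_quasi_iso : quasi_iso cone_to.
Proof.
have inji n : injective (i n) by case: (exact_ip n).
have exi n y : p n y = 0 -> exists x, y = i n x.
  by case: (exact_ip n) => _ ex _ /ex.
have surj n x : exists y, x = p n y by case: (exact_ip n).
move=> n; split=> [[k' q] /= [/eqP + dq] [x xE]|x dx].
  rewrite oppr_eq0 => /eqP dk'.
  have [q1 q1E] := surj n x.
  have [|k kE] := exi (n + 1) (q - diff P n q1).
    by rewrite linearB -comm_diff -q1E xE subrr.
  have dk : diff K (n + 1) k = - s _ k'.
    apply: inji; rewrite -comm_diff -kE linearB diffK subr0 linearN.
    by apply/eqP; rewrite -addr_eq0 [X in X == _]addrC dq.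
  have [||k1 k1E] := (qs (n + 1)).1 k'; first exact: dk'.
    by exists (- k); rewrite linearN dk opprK.
  have [|k2 [dk2 [k3 k3E]]] := (qs n).2 (s _ k1 + k).
    by rewrite linearD comm_diff dk k1E subrr.
  exists (k2 - k1, q1 + i n k3); apply: injective_projections => /=.
    by rewrite linearB dk2 sub0r opprK.
  rewrite linearD comm_diff -k3E addrCA -linearD linearB.
  rewrite [X in i _ X](_ : _ = k) -?kE ?subrKC //.
  by rewrite -[s _ k1 + k - _]addrA subrKA [LHS]addrC subrK.
have [q qE] := surj _ x.
have [|k kE] := exi (n + 1 + 1) (diff P (n + 1) q).
  by rewrite -comm_diff -qE dx.
have [|k'' [dk'' [k4 k4E]]] := (qs (n + 1)).2 k.
  by apply: inji; rewrite -comm_diff -kE diffK linear0.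
exists (- k'', q - i _ k4); split.
  apply: injective_projections => /=; first by rewrite linearN dk'' !oppr0.
  rewrite (linearB (diff P _)) comm_diff -k4E kE (linearB (i _)).
  rewrite (linearN (s _)) (linearN (i _)).
  by rewrite opprB addrCA addKr subrr.
exists 0; rewrite /= linearB -qE (short_exact_zero (exact_ip _)) subr0 subrr.
by rewrite linear0.
Qed.

End ConeOverExact.

Lemma prod_fst_quasi_iso X N : acyclic N -> quasi_iso (prod_fst X N).
Proof.
move=> aN i; split=> [[x n] [dx dn] [y /= yE]|x dx].
  have [m mE] := aN i n dn; exists (y, m).
  by apply: injective_projections; rewrite /= ?yE.
exists (x, 0); split; last by exists 0; rewrite /= subrr linear0.
by apply: injective_projections; rewrite /= ?dx ?linear0.
Qed.

Lemma transport_inj (X : int -> rmodType R) i j (e : i = j) :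
  injective (transport X e).
Proof. by case: j / e. Qed.

Lemma transportK (X : int -> rmodType R) i j (e : i = j) (x : X i) :
  transport X (esym e) (transport X e x) = x.
Proof. by case: j / e. Qed.

Lemma transportKV (X : int -> rmodType R) i j (e : i = j) (x : X j) :
  transport X e (transport X (esym e) x) = x.
Proof. by case: j / e x. Qed.

Lemma diff_transport X (i j : int) (e : i = j) (e' : i + 1 = j + 1) (x : X i) :
  diff X j (transport X e x) = transport X e' (diff X i x).
Proof. by case: j / e e' => e'; rewrite (eq_irrelevance e' erefl). Qed.

(** A contractible complex of projectives mapping onto X.  In degree i it is the
    sum of the free modules on X^i and on X^(i-1), with the identity of the former
    as differential; writing it as a cone makes contractibility immediate. *)
Section DiskCover.
Variable X : complex R.

Definition disk_base : complex R :=
  @Complex R (fun i => free_mod R (X (i - 1))) (fun i => \0) (fun i x => erefl).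

Definition disk_cover : complex R := cone (id_map disk_base).

Definition disk_map_ob i : {linear disk_cover i -> X i} :=
  copair_lin (transport X (addrK 1 i) \o free_ext id)
    (transport X (subrK 1 i) \o (diff X (i - 1) \o free_ext id)).

Lemma disk_map_comm i (q : disk_cover i) :
  diff X i (disk_map_ob i q) = disk_map_ob (i + 1) (diff disk_cover i q).
Proof.
case: q => a b.
have -> : diff disk_cover i (a, b) = (0, a).
  by apply: injective_projections => /=; [exact: oppr0 | exact: addr0].
have e : i + 1 - 1 + 1 = i + 1 by rewrite addrK.
rewrite -[disk_map_ob i _]/(transport X (addrK 1 i) (free_ext id a) +
  transport X (subrK 1 i) (diff X (i - 1) (free_ext id b))).
rewrite -[RHS]/(transport X (addrK 1 (i + 1)) (free_ext id 0) +
  transport X (subrK 1 (i + 1)) (diff X (i + 1 - 1) (free_ext id a))).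
rewrite !linear0 add0r linearD transport_diffK addr0.
by rewrite (diff_transport _ (subrK 1 (i + 1))).
Qed.

Definition disk_map : chain_map disk_cover X := ChainMap disk_map_comm.

Lemma disk_map_surjective : surjective disk_map.
Proof.
move=> i x; pose y := transport X (esym (addrK 1 i)) x.
exists (free_gen R y, 0).
rewrite -[RHS]/(transport X (addrK 1 i) (free_ext id (free_gen R y)) +
  transport X (subrK 1 i) (diff X (i - 1) (free_ext id 0))).
rewrite !linear0 addr0 free_ext_gen /y.
by rewrite transportKV.
Qed.

Lemma disk_cover_acyclic : acyclic disk_cover.
Proof. exact/cone_acyclic/id_quasi_iso. Qed.

Lemma disk_cover_projective i : projective_mod (disk_cover i).
Proof. by apply: projective_prod; exact: free_projective. Qed.

End DiskCover.

Lemma comp_surjective X Y Z (g : chain_map Y Z) (f : chain_map X Y) :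
  surjective g -> surjective f -> surjective (comp_map g f).
Proof. by move=> sg sf i z; have [y ->] := sg i z; have [x ->] := sf i y; exists x. Qed.

End ComplexTools.

Section Resolution.
Variables (R : pzRingType) (C : rmodType R) (E : nat -> rmodType R).
Variables (eta : {linear C -> E 0%N}) (d : forall i, {linear E i -> E i.+1}).
Hypothesis coresE : inj_coresolution eta d.

Definition ext_acyclic (Z : complex R) : Prop :=
  forall i, ext_vanish_above d 0 (Z i).

(** Induction on m: the kernel of the disk cover of X has smaller Ext dimension,
    and its resolution is spliced with the cover. *)
Lemma ext_resolution_above (m : nat) (X : complex R) :
  (forall i, ext_vanish_above d m (X i)) ->
  exists (Z : complex R) (s : chain_map Z X),
    [/\ ext_acyclic Z, quasi_iso s & surjective s].
Proof.
elim: m X => [|m IHm] X eX.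
  exists X, (id_map X); split=> //; first exact: id_quasi_iso.
  by move=> i x; exists x.
have exP := ker_short_exact (@disk_map_surjective R X).
have [i|Z [s [eZ qs surj_s]]] := IHm (ker_complex (disk_map X)).
  exact: (ext_vanish_syzygy coresE (exP i) (@disk_cover_projective _ _ _) (eX i)).
exists _, (cone_to s exP); split; last exact: cone_to_surjective.
- move=> i; apply: ext_vanish_prod; first exact: eZ.
  exact: (ext_vanish_projective coresE (@disk_cover_projective _ _ _)).
- exact: cone_to_quasi_iso.
Qed.

Lemma ext_resolution (n : nat) (X : complex R) :
  (forall i, (n < i)%N -> is_zero_mod (E i)) ->
  exists (Z : complex R) (s : chain_map Z X),
    [/\ ext_acyclic Z, quasi_iso s & surjective s].
Proof.
move=> E0; apply: (@ext_resolution_above n) => i k nk g _.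
exists \0 => x; rewrite [LHS]E0; [exact: esym (linear0 _) | exact: nk].
Qed.

End Resolution.

(** * Right fractions *)

Section Fractions.
Variable R : pzRingType.
Implicit Types X Y Z N : complex R.

Lemma neg_comm X Y (f : chain_map X Y) i (x : X i) :
  diff Y i ((\- f i : {linear X i -> Y i}) x)
  = (\- f (i + 1) : {linear X (i + 1) -> Y (i + 1)}) (diff X i x).
Proof. by rewrite /= linearN comm_diff. Qed.

Definition neg_map X Y (f : chain_map X Y) : chain_map X Y := ChainMap (neg_comm f).

Section Pullback.
Variables (X Y Z : complex R) (f : chain_map X Z) (s : chain_map Y Z).
Hypotheses (qs : quasi_iso s) (surj_s : surjective s).

Definition pullback : complex R := ker_complex (copair f (neg_map s)).
Definition pullback_fst : chain_map pullback X :=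
  comp_map (prod_fst X Y) (ker_incl (copair f (neg_map s))).
Definition pullback_snd : chain_map pullback Y :=
  comp_map (prod_snd X Y) (ker_incl (copair f (neg_map s))).

Lemma pullback_sq i (u : pullback i) : f i (pullback_fst i u) = s i (pullback_snd i u).
Proof. by apply/eqP; rewrite -subr_eq0; apply/eqP; exact: (sub_inclP u). Qed.

Lemma pullback_ex i x y : f i x = s i y ->
  exists u : pullback i, pullback_fst i u = x /\ pullback_snd i u = y.
Proof.
move=> fs; have [|u uE] := @ker_incl_ex _ _ _ (copair f (neg_map s)) i (x, y).
  by rewrite /= fs subrr.
exists u; rewrite -[pullback_fst i u]/(ker_incl _ i u).1.
by rewrite -[pullback_snd i u]/(ker_incl _ i u).2 uE.
Qed.

Lemma pullback_inj i (u v : pullback i) :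
  pullback_fst i u = pullback_fst i v -> pullback_snd i u = pullback_snd i v -> u = v.
Proof.
move=> uv1 uv2; apply: (@sub_incl_inj _ _ (ker_submodule (copair f (neg_map s) i))).
exact: injective_projections.
Qed.

Lemma pullback_fst_surjective : surjective pullback_fst.
Proof.
move=> i x; have [y yE] := surj_s (f i x).
by have [u [uE _]] := pullback_ex yE; exists u.
Qed.

(** A surjective quasi-isomorphism has acyclic kernel, which makes its strict
    pullbacks quasi-isomorphisms. *)
Lemma surjective_qis_kernel (i : int) (y : Y (i + 1)) :
  diff Y (i + 1) y = 0 -> s (i + 1) y = 0 ->
  exists2 y', s i y' = 0 & y = diff Y i y'.
Proof.
move: y; move: (i - 1) (subrK 1 i) => j e; case: i / e => y dy sy.
have [|w yE] := (qs (j + 1)).1 y dy; first by exists 0; rewrite sy linear0.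
have [|v [dv [z zE]]] := (qs j).2 (s _ w).
  by rewrite comm_diff -yE sy.
have [y2 y2E] := surj_s z.
exists (w - v - diff Y j y2).
  by rewrite !linearB -comm_diff -y2E -zE subrr.
by rewrite !linearB dv diffK !subr0.
Qed.

Lemma pullback_fst_quasi_iso : quasi_iso pullback_fst.
Proof.
move=> i; split=> [u du [x xE]|x dx].
  have [y yE] := surj_s (f i x).
  have [y' sy' y'E] : exists2 y', s i y' = 0 &
      pullback_snd (i + 1) u - diff Y i y = diff Y i y'.
    apply: surjective_qis_kernel.
      by rewrite linearB diffK comm_diff du linear0 subr0.
    by rewrite linearB -pullback_sq -comm_diff -yE xE comm_diff subrr.
  have [|v [v1 v2]] := @pullback_ex i x (y + y').
    by rewrite linearD sy' addr0.
  exists v; apply: pullback_inj; first by rewrite -comm_diff v1.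
  by rewrite -comm_diff v2 linearD -y'E subrKC.
have [|y [dy [z zE]]] := (qs i).2 (f _ x); first by rewrite comm_diff dx linear0.
have [y' y'E] := surj_s z.
have [|u [u1 u2]] := @pullback_ex (i + 1) x (y + diff Y i y').
  by rewrite linearD -comm_diff -y'E -zE subrKC.
exists u; split.
  apply: pullback_inj; rewrite -comm_diff linear0 ?u1 //.
  by rewrite u2 linearD diffK dy addr0.
by exists 0; rewrite u1 subrr linear0.
Qed.

End Pullback.

Lemma copair_quasi_iso X N Z (t : chain_map X Z) (g : chain_map N Z) :
  quasi_iso t -> acyclic N -> quasi_iso (copair t g).
Proof.
move=> qt aN i; split=> [[x n] [dx dn] [z /= zE]|z dz].
  have [m mE] := aN i n dn.
  have [|x' x'E] := (qt i).1 x dx.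
    by exists (z - g i m); rewrite linearB -zE comm_diff -mE addrK.
  by exists (x', m); apply: injective_projections.
have [x [dx [z' z'E]]] := (qt i).2 z dz.
exists (x, 0); split; last by exists z'; rewrite /= linear0 addr0.
by apply: injective_projections; rewrite /= ?dx ?linear0.
Qed.

(** Keeping denominators surjective lets composites be formed with strict
    pullbacks instead of homotopy pullbacks.  The inverse of t : X -> Y, which
    need not be surjective, becomes a fraction after adding to X a contractible
    complex that maps onto Y. *)
Theorem right_fraction X Y (u : Dmor X Y) :
  exists (N : complex R) (s : chain_map N X) (f : chain_map N Y),
    [/\ quasi_iso s, surjective s & Deq (Dcomp u (Dloc s)) (Dloc f)].
Proof.
elim: u => {X Y} [X Y f|X Y t qt|X Y Z v [N2 [s2 [f2 [qs2 surj2 E2]]]]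
                               u [N [s [f [qs surj E]]]]].
- exists X, (id_map X), f; split; first exact: id_quasi_iso.
    by move=> i x; exists x.
  exact: Deq_idr.
- pose p := prod_fst X (disk_cover Y).
  pose s := copair t (disk_map Y).
  have qp : quasi_iso p by exact/prod_fst_quasi_iso/disk_cover_acyclic.
  have inc_comm i (x : X i) :
      diff (prod_complex X (disk_cover Y)) i (inl_lin (X i) (disk_cover Y i) x)
      = inl_lin (X (i + 1)) (disk_cover Y (i + 1)) (diff X i x).
    by apply: injective_projections; last exact: (linear0 (diff (disk_cover Y) i)).
  pose inc : chain_map X (prod_complex X (disk_cover Y)) :=
    @ChainMap R X (prod_complex X (disk_cover Y)) (fun i => inl_lin _ _) inc_comm.
  have pinc : Deq (Dcomp (Dloc p) (Dloc inc)) (Dloc (id_map X)).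
    by rewrite -Deq_loc_comp; apply: Deq_loc_ext.
  have incp : Deq (Dcomp (Dloc inc) (Dloc p)) (Dloc (id_map _)).
    apply: (Dinv_cancell qp); rewrite Deq_assoc pinc.
    by rewrite Deq_idl Deq_idr.
  (* s and t p agree on X, and p is inverse to the inclusion of X. *)
  have tp : Deq (Dloc s) (Dcomp (Dloc t) (Dloc p)).
    rewrite -(Deq_idr (Dloc s)) -incp Deq_assoc -(Deq_loc_comp s inc).
    have -> : Deq (Dloc (comp_map s inc)) (Dloc t); last by [].
    apply: Deq_loc_ext => i x.
    by rewrite -[LHS]/(t i x + disk_map Y i 0) linear0 addr0.
  exists _, s, p; split.
  + exact/copair_quasi_iso/disk_cover_acyclic.
  + move=> i y; have [q ->] := disk_map_surjective y.
    by exists (0, q); rewrite -[RHS]/(t i 0 + disk_map Y i q) linear0 add0r.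
  + by rewrite tp Deq_assoc Deq_invl Deq_idl.
exists _, (comp_map s (pullback_fst f s2)), (comp_map f2 (pullback_snd f s2)); split.
- exact/comp_quasi_iso/pullback_fst_quasi_iso.
- exact/comp_surjective/pullback_fst_surjective.
rewrite !Deq_loc_comp -Deq_assoc (Deq_assoc u) E -E2.
rewrite -(Deq_assoc v) -!Deq_loc_comp.
have -> : Deq (Dloc (comp_map f (pullback_fst f s2)))
              (Dloc (comp_map s2 (pullback_snd f s2))); last by [].
by apply: Deq_loc_ext => i x; exact: pullback_sq.
Qed.

End Fractions.

(** * Maps from a complex to the shifts of C *)

Section MapsToC.
Variables (R : pzRingType) (C : rmodType R) (E : nat -> rmodType R).
Variables (eta : {linear C -> E 0%N}) (d : forall i, {linear E i -> E i.+1}).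
Hypothesis coresE : inj_coresolution eta d.
Variable n : nat.
Hypothesis E_eq0 : forall i, (n < i)%N -> is_zero_mod (E i).
Implicit Types (M : rmodType R) (X Y Z N : complex R).

Lemma rV0_zero : is_zero_mod ('rV[R^c]_0 : rmodType R).
Proof. by move=> x; apply/rowP => -[]. Qed.

(** The coresolution E as a complex over the integers, zero in negative
    degrees. *)
Definition cores_ob (i : int) : rmodType R :=
  match i with Posz k => E k | Negz _ => 'rV[R^c]_0 end.

Lemma Posz_succ k : Posz k.+1 = Posz k + 1.
Proof. by rewrite -addn1 PoszD. Qed.

Definition cores_diff (i : int) : {linear cores_ob i -> cores_ob (i + 1)} :=
  match i return {linear cores_ob i -> cores_ob (i + 1)} with
  | Posz k => transport cores_ob (Posz_succ k) \o d k
  | Negz k => \0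
  end.

Arguments cores_diff : clear implicits.

Lemma cores_diff_transport k j (e : Posz k.+1 = j) (e' : Posz k.+2 = j + 1)
    (x : E k.+1) :
  cores_diff j (transport cores_ob e x) = transport cores_ob e' (d k.+1 x).
Proof. by case: j / e e' => e'; rewrite (eq_irrelevance e' (Posz_succ _)). Qed.

Lemma cores_diffK i (x : cores_ob i) : cores_diff (i + 1) (cores_diff i x) = 0.
Proof.
case: i x => k x; last exact: linear0.
have e : Posz k.+2 = Posz k + 1 + 1 by rewrite -!Posz_succ.
apply: etrans (cores_diff_transport (Posz_succ k) e (d k x)) _.
have [_ _ _ exE] := coresE.
have -> : d k.+1 (d k x) = 0 by apply/exE; exists x.
exact: linear0.
Qed.

Definition cores_complex : complex R :=
  @Complex R cores_ob cores_diff cores_diffK.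

Definition aug_lin (i : int) : {linear stalk_ob C i -> cores_ob i} :=
  match i return {linear stalk_ob C i -> cores_ob i} with
  | Posz 0 => eta
  | Posz k.+1 => \0
  | Negz k => \0
  end.

Arguments aug_lin : clear implicits.

Lemma aug_comm i (x : stalk C i) :
  diff cores_complex i (aug_lin i x) = aug_lin (i + 1) (diff (stalk C) i x).
Proof.
have [_ _ ex0 _] := coresE.
rewrite [RHS]linear0; case: i x => [[|k]|k] x; [|exact: linear0|exact: linear0].
rewrite /= (_ : d 0%N (eta x) = 0) ?linear0 //.
by apply/ex0; exists x.
Qed.

Definition aug : chain_map (stalk C) cores_complex := ChainMap aug_comm.

Lemma cores_exact M (p q : int) (e : p + 1 = q) (g : {linear M -> cores_ob q}) :
  ext_vanish_above d 0 M -> 0 <= p -> (forall x, cores_diff q (g x) = 0) ->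
  exists t : {linear M -> cores_ob p},
    forall x, g x = transport cores_ob e (cores_diff p (t x)).
Proof.
case: p e => // k e eM _; have e' : Posz k.+1 = q by rewrite Posz_succ.
have eE (x : E k.+1) : transport cores_ob e (transport cores_ob (Posz_succ k) x)
    = transport cores_ob e' x.
  by case: q / e e' {g} => e'; rewrite (eq_irrelevance e' (Posz_succ k)).
move=> dg; have [t tE] : exists t : {linear M -> E k}, forall x,
    g x = transport cores_ob e' (d k (t x)).
  case: q / e' g dg {e eE} => g dg; apply: eM => // x.
  by apply: (@transport_inj _ cores_ob _ _ (Posz_succ k.+1)); rewrite linear0; apply: dg.
by exists t => x; rewrite tE -eE.
Qed.

Lemma cores_lift0 M (k : int) (g : {linear M -> cores_ob k}) :
  k = 0 -> (forall x, cores_diff k (g x) = 0) ->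
  exists psi : {linear M -> stalk_ob C k}, forall x, g x = aug_lin k (psi x).
Proof.
move=> k0; move: g; rewrite k0 => g dg; have [_ inj_eta ex0 _] := coresE.
apply: lin_lift inj_eta _ => x; apply/ex0.
by apply: (@transport_inj _ cores_ob _ _ (Posz_succ 0)); rewrite linear0; apply: dg.
Qed.

Lemma stalk_ob_zero (k : int) : k != 0 -> is_zero_mod (stalk_ob C k).
Proof. by rewrite /stalk_ob => /negPf ->; exact: rV0_zero. Qed.

Lemma aug_lin_inj k : injective (aug_lin k).
Proof.
have [k0|k0] := eqVneq k 0; first by have [_ inj_eta _ _] := coresE; rewrite k0.
by move=> x y _; rewrite (stalk_ob_zero k0 x) (stalk_ob_zero k0 y).
Qed.

Lemma cores_ob_zero k : (k < 0) || (n%:Z < k) -> is_zero_mod (cores_ob k).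
Proof. by case: k => k; [exact: E_eq0 | move=> _; exact: rV0_zero]. Qed.

Lemma cores_ob_injective k : injective_mod (cores_ob k).
Proof.
case: k => k; first by have [injE _ _ _] := coresE; exact: injE.
move=> M N i f _; exists \0 => x.
by rewrite [LHS]rV0_zero [RHS]rV0_zero.
Qed.

Lemma cores_shift_K_injective j : K_injective (shift j cores_complex).
Proof.
apply: (@bounded_below_K_injective _ _ (- j)) => i; first exact: cores_ob_injective.
by move=> ij; apply: cores_ob_zero; rewrite -ltrBrDr sub0r ij.
Qed.

Lemma shift1_cores_K_injective j : K_injective (shift 1 (shift j cores_complex)).
Proof.
apply: (@bounded_below_K_injective _ _ (- j - 1)) => i; first exact: cores_ob_injective.
by move=> ij; apply: cores_ob_zero; rewrite -ltrBrDr sub0r -ltrBrDr ij.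
Qed.

Lemma shift_diff_eq0 j X i (x : X (i + j)) :
  diff (shift j X) i x = 0 <-> diff X (i + j) x = 0.
Proof.
rewrite /= /shift_diff sign_linE /=.
have t0 y : transport X (shift_index j i) y = 0 <-> y = 0.
  split=> [ty|->]; last exact: linear0.
  by apply: (transport_inj (e := shift_index j i)); rewrite ty linear0.
case: ifP => _; rewrite ?t0 //; split=> [/eqP|/t0 ->]; last exact: oppr0.
by rewrite oppr_eq0 => /eqP /t0.
Qed.

Lemma shift_diff_lift j X i M (t : {linear M -> X (i + j)}) :
  exists t' : {linear M -> shift j X i}, forall x,
    transport X (shift_index j i) (diff X (i + j) (t x)) = diff (shift j X) i (t' x).
Proof.
rewrite /= /shift_diff; case: (boolP (odd `|j|)) => oj; [exists (\- t) | exists t] => x;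
  by rewrite sign_linE ?oj ?(negPf oj) //= !linearN opprK.
Qed.

(** Hom(Z, C) is exact at Hom(Z^(b+1), C).  Indexing by b keeps the three
    consecutive degrees b, b + 1, b + 1 + 1 of the definitional form that the
    differentials have. *)
Definition C_exact (b : int) Z : Prop :=
  forall phi : {linear Z (b + 1) -> C}, (forall x, phi (diff Z b x) = 0) ->
  exists psi : {linear Z (b + 1 + 1) -> C}, forall x, phi x = psi (diff Z (b + 1) x).

(** Comparison of homotopies with values in E and in C.  As f vanishes above
    degree b + 1, the components of the homotopy there satisfy
    d h_i + h_(i+1) d = 0.  The topmost one, h_i with i + j = n, is a cocycle with
    values in E; going down, h_(i+1) is replaced by a cocycle, which is a
    coboundary d t since Z is ext-acyclic, and h_i + t d is a cocycle again.  In
    degree b + 1 a cocycle with values in E^0 is a map to C. *)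
Lemma null_after_aug (j b : int) Z (f : chain_map Z (shift j (stalk C))) :
  ext_acyclic d Z -> b + 1 + j = 0 ->
  homotopic (comp_map (shift_map j aug) f) (zero_map Z (shift j cores_complex)) ->
  exists psi : {linear Z (b + 1 + 1) -> shift j (stalk C) (b + 1)},
    forall x, f (b + 1) x = psi (diff Z (b + 1) x).
Proof.
move=> eZ bj [h hE].
have claim (k : nat) : forall i, b + 1 <= i -> n%:Z < i + j + k%:Z ->
    exists h' : {linear Z (i + 1) -> shift j cores_complex i},
      (forall x, diff (shift j cores_complex) i (h' x) = 0) /\
      (forall x, h' (diff Z i x) = h i (diff Z i x)).
  elim: k => [|k IHk] i bi nk.
    exists (h i); split=> // x; apply/shift_diff_eq0.
    rewrite addr0 in nk.
    have z0 := @cores_ob_zero (i + j) _ (h i x).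
    rewrite [h i x]z0 ?nk ?orbT //; exact: linear0.
  have [||h' [dh' h'E]] := IHk (i + 1).
  - by rewrite (le_trans bi) // lerDl.
  - by move: nk; rewrite -addn1 PoszD addrA addrAC [in i + j + 1]addrAC.
  have [| |t0 t0E] := @cores_exact _ _ _ (shift_index j i) h' (eZ _).
  - by move: bi; rewrite -(lerD2r j) bj.
  - by move=> x; apply/(@shift_diff_eq0 j cores_complex); exact: dh'.
  have [t tE] := @shift_diff_lift j cores_complex _ _ t0.
  exists (h i \+ (t \o diff Z (i + 1) : {linear _ -> _})); split=> x; last first.
    by rewrite /= diffK linear0 addr0.
  have fx0 : f (i + 1) x = 0.
    apply: (@stalk_ob_zero (i + 1 + j)); rewrite gt_eqF // addrAC.
    by rewrite ltzD1 -bj lerD2r.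
  rewrite -[LHS]/(diff (shift j cores_complex) i (h i x + t (diff Z (i + 1) x))).
  rewrite linearD -tE.
  have <- := t0E (diff Z (i + 1) x).
  rewrite h'E [LHS]addrC -hE.
  rewrite -[comp_map _ _ _ _]/(shift_map j aug (i + 1) (f (i + 1) x)) fx0.
  rewrite linear0; exact: subr0.
have [|h' [dh' h'E]] := claim n.+1 (b + 1) (lexx _); first by rewrite bj add0r ltz_nat.
have [psi psiE] := @cores_lift0 _ _ h' bj
  (fun x => (@shift_diff_eq0 j cores_complex _ _).1 (dh' x)).
exists psi => x; apply: (@aug_lin_inj (b + 1 + j)).
have := hE b x; rewrite -h'E psiE.
have bj0 : b + j < 0 by rewrite -bj addrAC ltzD1.
have -> : h b x = 0 by apply: (@cores_ob_zero (b + j)); rewrite bj0.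
rewrite (linear0 (diff (shift j cores_complex) b)) addr0 => <-.
exact: esym (subr0 _).
Qed.

(** A cocycle on Z^(b+1) is the same as a chain map to Sigma^j C. *)
Lemma C_exact_of_null (j b : int) Z : b + 1 + j = 0 ->
  (forall f : chain_map Z (shift j (stalk C)),
     exists psi : {linear Z (b + 1 + 1) -> shift j (stalk C) (b + 1)},
       forall x, f (b + 1) x = psi (diff Z (b + 1) x)) ->
  C_exact b Z.
Proof.
move=> bj null phi phid.
have gP i : exists g : {linear Z i -> stalk_ob C (i + j)},
    forall (e : b + 1 = i) (e0 : 0 = i + j) x,
      g (transport Z e x) = transport (stalk_ob C) e0 (phi x).
  have [ib|ib] := eqVneq (b + 1) i; last by exists \0 => e; rewrite e eqxx in ib.
  case: i / ib; exists (transport (stalk_ob C) (esym bj) \o phi) => e e0 x.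
  by rewrite (eq_irrelevance e erefl) (eq_irrelevance e0 (esym bj)).
pose g i := sval (cid (gP i)).
have gC i (x : Z i) : diff (shift j (stalk C)) i (g i x) = g (i + 1) (diff Z i x).
  have -> : diff (shift j (stalk C)) i (g i x) = 0.
    by apply/(@shift_diff_eq0 j (stalk C)).
  have [ij|ij] := eqVneq (i + 1 + j) 0; last first.
    by rewrite (stalk_ob_zero ij (g (i + 1) _)).
  have ib : i = b by apply/(addIr 1)/(addIr j); rewrite ij bj.
  subst i; have := svalP (cid (gP (b + 1))) erefl (esym bj) (diff Z b x).
  by rewrite /= phid linear0.
have [psi psiE] := null (ChainMap gC).
exists (transport (stalk_ob C) bj \o psi) => x.
apply: (@transport_inj _ (stalk_ob C) _ _ (esym bj)).
apply: etrans (esym (svalP (cid (gP (b + 1))) erefl (esym bj) x)) _.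
apply: etrans (psiE x) _.
exact: esym (@transportK _ (stalk_ob C) _ _ bj _).
Qed.

Lemma homotopic0_of_C_exact (j b : int) Z (f : chain_map Z (shift j (stalk C))) :
  b + 1 + j = 0 -> C_exact b Z -> homotopic f (zero_map Z (shift j (stalk C))).
Proof.
move=> bj exZ.
have hP i : exists h : {linear Z (i + 1) -> stalk_ob C (i + j)},
    forall x, f i x = h (diff Z i x).
  have [ij|ij] := eqVneq (i + j) 0; last first.
    by exists \0 => x; rewrite [LHS](stalk_ob_zero ij _).
  have ib : i = b + 1 by apply/(addIr j); rewrite ij bj.
  subst i.
  have [x|psi psiE] := exZ (transport (stalk_ob C) bj \o f (b + 1)).
    rewrite /= -comm_diff (_ : diff _ _ _ = 0) ?linear0 //.
    by apply/(@shift_diff_eq0 j (stalk C)).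
  exists (transport (stalk_ob C) (esym bj) \o psi) => x.
  rewrite /= -psiE; exact: esym (@transportK _ (stalk_ob C) _ _ bj _).
exists (fun i => sval (cid (hP i))) => i x.
have -> : diff (shift j (stalk C)) i (sval (cid (hP i)) x) = 0.
  by apply/(@shift_diff_eq0 j (stalk C)).
rewrite -(svalP (cid (hP (i + 1)))) addr0; exact: subr0.
Qed.

Lemma acyclic_C_exact b N : ext_acyclic d N -> acyclic N -> C_exact b N.
Proof.
move=> eN aN; pose j := - (b + 1).
have bj : b + 1 + j = 0 by rewrite subrr.
apply: (C_exact_of_null bj) => f; apply: null_after_aug => //.
exact: cores_shift_K_injective.
Qed.

(** The long exact sequence of the cone of s for Hom(-, C), the cone being
    acyclic and ext-acyclic. *)
Lemma quasi_iso_C_exact b X Y (s : chain_map X Y) :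
  ext_acyclic d X -> ext_acyclic d Y -> quasi_iso s ->
  C_exact b Y -> C_exact b X.
Proof.
move=> eX eY qs; move: (b - 1) (subrK 1 b) => c e; case: b / e => exY phi phid.
have eCone : ext_acyclic d (cone s) by move=> i; apply: ext_vanish_prod.
have exCone : C_exact c (cone s) by apply: acyclic_C_exact (cone_acyclic qs).
have [[x y]|psi psiE] := exCone (phi \o fst_lin _ _).
  by rewrite /= linearN phid oppr0.
have [y|chi chiE] := exY (psi \o cone_in s (c + 1 + 1) : {linear _ -> _}).
  rewrite -[LHS]/(psi (cone_in s _ (diff Y (c + 1) y))) -(comm_diff (cone_in s)).
  by rewrite -psiE /= linear0.
exists ((chi \o s (c + 1 + 1 + 1)) \- (psi \o inl_lin _ _) : {linear _ -> _}) => x.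
have := psiE (x, 0); rewrite /= => ->.
rewrite -comm_diff -chiE /= -linearB; congr (psi _).
by apply: injective_projections; rewrite /= ?linear0 ?addr0 ?subr0 ?sub0r.
Qed.

(** On ext-acyclic complexes, maps to Sigma^j C in the derived category are
    computed naively. *)
Lemma DHom_eq0_C_exact (j b : int) Z : ext_acyclic d Z -> b + 1 + j = 0 ->
  DHom_eq0 Z (shift j (stalk C)) <-> C_exact b Z.
Proof.
move=> eZ bj; split=> [Z0|exZ u].
  apply: (C_exact_of_null bj) => f; apply: null_after_aug => //.
  apply: Deq0_homotopic0; [exact: cores_shift_K_injective |
    exact: shift1_cores_K_injective |].
  by rewrite Deq_loc_comp (Z0 (Dloc f)) Dloc_comp0.
have [N [s [f [qs _ us]]]] := right_fraction u.
have [N' [t [eN' qt _]]] := ext_resolution coresE N E_eq0.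
apply: (Dinv_cancelr (comp_quasi_iso qs qt)).
rewrite Deq_loc_comp Deq_assoc us -Deq_loc_comp -Deq_loc_comp.
rewrite (homotopic0_Deq (homotopic0_of_C_exact (comp_map f t) bj _)).
  by symmetry; rewrite Dloc_0comp.
exact: quasi_iso_C_exact eN' eZ (comp_quasi_iso qs qt) exZ.
Qed.

End MapsToC.

(** * Truncation *)

Section Truncation.
Variables (R : pzRingType) (C : rmodType R) (E : nat -> rmodType R).
Variables (eta : {linear C -> E 0%N}) (d : forall i, {linear E i -> E i.+1}).
Hypothesis ext_C : forall I : Type, ext_vanish_above d 0 (I -> C : rmodType R).

Section Construction.
Variable X : complex R.

(** The complex L and the differential D of X + L, by recursion on the degree.
    The recursion carries the set S i of boundaries in degree i next to L i,
    because the index set of L (i + 1) depends on it.  Besides the differential,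
    each step records the two properties of evaluation: maps to C killing
    boundaries factor through D, and a map delta extends the L-component of
    D alpha as soon as all such maps factor through delta after alpha. *)
Lemma truncation_data : exists (L : int -> rmodType R)
    (S : forall i, (X i * L i)%type -> Prop)
    (D : forall i, {linear (X i * L i)%type -> (X (i + 1)%R * L (i + 1)%R)%type}),
  [/\ (forall i, i <= 1 -> is_zero_mod (L i)),
      (forall i, ext_vanish_above d 0 (L i)),
      (forall i p, (D i p).1 = diff X i p.1) /\ (forall i p, S i p -> D i p = 0),
      (forall i q, S (i + 1) q <-> exists p, q = D i p)
    & (forall i, 1 <= i -> forall phi : {linear (X i * L i)%type -> C},
         (forall p, S i p -> phi p = 0) ->
         exists psi : {linear (X (i + 1)%R * L (i + 1)%R)%type -> C},
           forall p, phi p = psi (D i p)) /\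
      (forall i (N N' : rmodType R) (alpha : {linear N -> (X i * L i)%type})
         (delta : {linear N -> N'}),
         (1 <= i -> forall phi : {linear (X i * L i)%type -> C},
            (forall p, S i p -> phi p = 0) ->
            exists psi : {linear N' -> C}, forall x, phi (alpha x) = psi (delta x)) ->
         exists lam : {linear N' -> L (i + 1)},
           forall x, lam (delta x) = (D i (alpha x)).2)].
Proof.
pose T i := {L : rmodType R & (X i * L)%type -> Prop}.
pose inv i (t : T i) := [/\ i <= 1 -> is_zero_mod (projT1 t),
  ext_vanish_above d 0 (projT1 t) & forall p, projT2 t p -> diff X i p.1 = 0].
pose rel i (t : T i) (t' : T (i + 1)) :=
  exists D : {linear (X i * projT1 t)%type -> (X (i + 1)%R * projT1 t')%type},
  [/\ forall p, (D p).1 = diff X i p.1,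
      forall p, projT2 t p -> D p = 0,
      forall q, projT2 t' q <-> exists p, q = D p,
      1 <= i -> forall phi : {linear (X i * projT1 t)%type -> C},
         (forall p, projT2 t p -> phi p = 0) ->
         exists psi : {linear (X (i + 1)%R * projT1 t')%type -> C},
           forall p, phi p = psi (D p)
    & forall (N N' : rmodType R) (alpha : {linear N -> (X i * projT1 t)%type})
         (delta : {linear N -> N'}),
         (1 <= i -> forall phi : {linear (X i * projT1 t)%type -> C},
            (forall p, projT2 t p -> phi p = 0) ->
            exists psi : {linear N' -> C}, forall x, phi (alpha x) = psi (delta x)) ->
         exists lam : {linear N' -> projT1 t'},
           forall x, lam (delta x) = (D (alpha x)).2].
(* Up to degree 1, L is zero and the boundaries are those of X. *)
pose t0 i : T i := existT _ ('rV[R^c]_0 : rmodType R)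
  (fun q => exists j (e : j + 1 = i) (x : X j), q = (transport X e (diff X j x), 0)).
have [i i1|i i1|i i1 [L S] /= [_ eL dS]|t invt relt] :=
    @int_dependent_choice_inv T inv rel 1 t0.
- split=> [_||p [j [e [x ->]]]]; [exact: rV0_zero | | exact: transport_diffK].
  exact/ext_vanish_zero/rV0_zero.
- exists (pair_lin (diff X i \o fst_lin _ _) \0); split=> //.
  + move=> p [j [e [x ->]]]; apply: injective_projections => //=.
    exact: transport_diffK.
  + move=> q; split=> [[j [e [x ->]]]|[p ->]]; last first.
      by exists i, erefl, p.1.
    have ji : j = i by apply: (addIr 1).
    by subst j; exists (x, 0); rewrite (eq_irrelevance e erefl).
  + by rewrite leNgt i1.
  + by move=> N N' alpha delta _; exists \0.
- pose I := {phi : {linear (X i * L)%type -> C} | forall p, S p -> phi p = 0}.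
  have lev : linear ((fun p phi => sval phi p) : (X i * L)%type -> (I -> C : rmodType R)).
    by move=> a x y; apply/funext => phi; rewrite linearP.
  pose D := pair_lin (diff X i \o fst_lin (X i) L) (linear_of lev).
  exists (existT (fun L : rmodType R => (X (i + 1)%R * L)%type -> Prop)
    (I -> C : rmodType R) (fun q => exists p, q = D p)).
    split=> [i0||q [p ->]]; [| exact: ext_C | exact: diffK].
    by have := le_trans (lerD i1 (lexx 1)) i0.
  exists D; split=> //.
  + move=> p Sp; apply: injective_projections; first exact: dS.
    by apply/funext => -[phi /= phiS]; apply: phiS.
  + move=> _ phi phiS.
    have lpsi : linear ((fun q => q.2 (exist _ phi phiS)) :
        (X (i + 1)%R * (I -> C))%type -> C) by [].
    by exists (linear_of lpsi).
  + move=> N N' alpha delta /(_ i1) fac.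
    pose lam (phi : I) := sval (cid (fac _ (svalP phi))).
    exists (tuple_lin lam) => x; apply/funext => phi.
    by rewrite /= -(svalP (cid (fac _ (svalP phi)))).
exists (fun i => projT1 (t i)), (fun i => projT2 (t i)), (fun i => sval (cid (relt i))).
split=> [i|i|||].
- by case: (invt i).
- by case: (invt i).
- by split=> i; case: (svalP (cid (relt i))) => D1 D2 _ _ _ p; [exact: D1 | exact: D2].
- by move=> i q; case: (svalP (cid (relt i))) => _ _ D3 _ _; exact: D3.
- by split=> i; case: (svalP (cid (relt i))) => _ _ _ D4 D5; [exact: D4 | exact: D5].
Qed.

(** With A the complex X + L and g its projection, L vanishes in degrees at most
    1, so in the range b < 0 maps to C on A and on X, and cocycles on the cone of g,
    are compared by the section x |-> (x, 0). *)
Lemma truncation : ext_acyclic d X ->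
  exists (A : complex R) (g : chain_map A X),
  [/\ ext_acyclic d A,
      forall b, 0 <= b -> C_exact C b A,
      forall b, b < 0 -> C_exact C b (cone g),
      (forall b, b < 0 -> C_exact C b X) -> forall b, b < 0 -> C_exact C b A
    & forall (Z : complex R) (f : chain_map Z X),
        (forall b, 0 <= b -> C_exact C b Z) ->
        exists alpha : chain_map Z A, forall i x, f i x = g i (alpha i x)].
Proof.
move=> eX.
have [L [S [D [L0 eL [D1 D2] D3 [D4 D5]]]]] := truncation_data.
have DK i p : D (i + 1) (D i p) = 0 by apply: D2; apply/D3; exists p.
pose A := @Complex R (fun i => (X i * L i)%type) D DK.
have gC i (p : A i) : diff X i (fst_lin (X i) (L i) p)
    = fst_lin (X (i + 1)) (L (i + 1)) (diff A i p) by rewrite /= D1.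
pose g : chain_map A X := @ChainMap R A X (fun i => fst_lin (X i) (L i)) gC.
have DE i (x : X i) (l : L i) : i < 1 -> D i (x, l) = (diff X i x, 0).
  move=> i1; apply: injective_projections; first by rewrite D1.
  by apply: L0; rewrite lezD1.
exists A, g; split.
- by move=> i; apply: ext_vanish_prod.
- move=> b b0 phi phid; apply: D4 => [|p]; first by rewrite lerDr.
  by move=> /D3[q ->]; exact: phid.
- move=> b b0 phi phid.
  have b1 : b + 1 < 1 by rewrite gtrDr.
  exists (phi \o pair_lin (pair_lin (snd_lin _ _) \0) \0 : {linear cone g _ -> C}).
  move=> [[x l] y].
  pose u : cone g (b + 1) := ((x + diff X (b + 1) y, 0), 0).
  pose v : cone g (b + 1) := (- D (b + 1) (y, 0), y).
  have phiv : phi v = 0.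
    rewrite -(phid ((y, 0), 0)); congr (phi _).
    apply: injective_projections => //.
    exact: esym (etrans (congr1 _ (linear0 (diff X b))) (addr0 _)).
  have uv : ((x, l), y) = u + v.
    apply: injective_projections; last by rewrite /= add0r.
    apply: injective_projections; first by rewrite /v DE //= addrK.
    have L00 := L0 (b + 1 + 1); rewrite lezD1 in L00.
    exact: etrans (L00 b1 _) (esym (L00 b1 _)).
  by transitivity (phi u); first by rewrite uv linearD phiv addr0.
- move=> exX b b0 phi phid.
  have b1 : b < 1 by exact: lt_trans b0 _.
  have b1' : b + 1 < 1 by rewrite gtrDr.
  have [x|psi psiE] := exX b b0 (phi \o inl_lin _ _).
    by rewrite /= -(DE _ _ 0 b1); apply: phid.
  exists (psi \o fst_lin _ _) => -[x l]; rewrite /= D1 -psiE /=.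
  by rewrite (L0 (b + 1) (ltW b1') l).
- move=> Z f exZ.
  (* The lift is (f, lam).  Its continuation to degree i + 1 asks that maps to C
     killing the boundaries of A factor through the differential of Z, which
     is exactness of Hom(Z, C). *)
  pose inv i (lam : {linear Z i -> L i}) := 1 <= i ->
    forall phi : {linear (X i * L i)%type -> C}, (forall p, S i p -> phi p = 0) ->
    exists psi : {linear Z (i + 1) -> C},
      forall x, phi (pair_lin (f i) lam x) = psi (diff Z i x).
  pose rel i (lam : {linear Z i -> L i}) (lam' : {linear Z (i + 1) -> L (i + 1)}) :=
    forall x, lam' (diff Z i x) = (D i (pair_lin (f i) lam x)).2.
  have [i i0|i i0 x|i i0 lam inv_lam|lam _ relE] :=
      @int_dependent_choice_inv _ inv rel 0 (fun i => \0).
  + by move=> i1; have := le_trans i1 i0.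
  + by rewrite DE //; exact: lt_trans i0 _.
  + have [lam' lamE] := D5 i _ _ (pair_lin (f i) lam) (diff Z i) inv_lam.
    exists lam' => // _ phi phiS.
    have [x|psi psiE] := exZ i i0 (phi \o pair_lin (f (i + 1)) lam').
      apply: phiS; apply/D3; exists (pair_lin (f i) lam x).
      apply: injective_projections; last exact: lamE.
      by rewrite D1 /= comm_diff.
    by exists psi.
  have aC i x : diff A i (pair_lin (f i) (lam i) x)
      = pair_lin (f (i + 1)) (lam (i + 1)) (diff Z i x).
    apply: injective_projections; first by rewrite D1 /= comm_diff.
    by rewrite /= relE.
  by exists (@ChainMap R Z A (fun i => pair_lin (f i) (lam i)) aC).
Qed.

End Construction.
End Truncation.

(** * Acyclicity from maps to C *)

Section Detection.
Variables (R : pzRingType) (C : rmodType R) (E : nat -> rmodType R).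
Variables (eta : {linear C -> E 0%N}) (d : forall i, {linear E i -> E i.+1}).
Hypothesis coresE : inj_coresolution eta d.
Variable A : complex R.
Hypotheses (eA : ext_acyclic d A) (exA : forall b, C_exact C b A).

Lemma Prod_exact (M : rmodType R) b (phi : {linear A (b + 1) -> M}) :
  in_Prod C M -> (forall x, phi (diff A b x) = 0) ->
  exists psi : {linear A (b + 1 + 1) -> M},
    forall x, phi x = psi (diff A (b + 1) x).
Proof.
move=> /in_Prod_retract[I [j [q qj]]] phid.
have /choice[h hE] k : exists h : {linear A (b + 1 + 1) -> C},
    forall x, j (phi x) k = h (diff A (b + 1) x).
  apply: (@exA b (coord_lin C k \o (j \o phi) : {linear _ -> C})) => x.
  by rewrite /= phid linear0.
exists (q \o tuple_lin h : {linear _ -> M}) => x /=.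
by rewrite -[LHS]qj; congr (q _); apply/funext => k; rewrite hE.
Qed.

Section Resolved.
Variables (r : nat) (Cs : nat -> rmodType R) (dC : forall k, {linear Cs k.+1 -> Cs k}).
Hypothesis ProdC : forall k, (0 < k <= r)%N -> in_Prod C (Cs k).
Hypothesis zeroC : forall k, (r < k)%N -> is_zero_mod (Cs k).
Hypothesis exC : forall k, exact_at (dC k.+1) (dC k).

(** If all Hom(A, C) are exact, so is Hom(A, -) on the resolution, up to
    boundaries dC chi coming from the resolution itself: phi d is a cycle, lifts
    to the next term, and the induction is applied to the lift one degree lower
    in A. *)
Lemma resolution_exact k b (phi : {linear A (b + 1) -> Cs k.+1}) :
  (forall x, dC k (phi (diff A b x)) = 0) ->
  exists (psi : {linear A (b + 1 + 1) -> Cs k.+1})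
         (chi : {linear A (b + 1) -> Cs k.+2}),
    forall x, phi x = psi (diff A (b + 1) x) + dC k.+1 (chi x).
Proof.
have [m] := ubnP (r.+1 - k); elim: m k b phi => // m IHm k b phi le_m.
move: (b - 1) (subrK 1 b) phi => c e; case: b / e => phi dphi.
have [kr|rk] := ltnP k r; last first.
  exists \0, \0 => x; rewrite (@zeroC k.+1 _ (phi x)) //.
  exact: esym (etrans (add0r _) (linear0 _)).
have [phi' phi'E] := lift_through_Prod_resolution coresE ProdC zeroC exC
  (f := phi \o diff A (c + 1) : {linear _ -> _}) (@exC k) (@eA (c + 1)) dphi.
have [||psi [chi pcE]] := IHm k.+1 c phi'.
- by rewrite subSS; move: le_m; rewrite subSn ?ltnS // ltnW.
- by move=> x; rewrite -phi'E /= diffK linear0.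
have [||psi' psi'E] := Prod_exact (phi := phi \- (dC k.+1 \o psi : {linear _ -> _}))
    (ProdC (k := k.+1) _).
- by [].
- move=> x; rewrite /= -[phi _]/((phi \o diff A (c + 1)) x) phi'E -linearB.
  by rewrite pcE addrC addKr; apply/exC; exists (chi x).
exists psi', psi => x.
by rewrite -psi'E /= subrK.
Qed.

End Resolved.

(** Splicing Q in front of its resolution, as the term of index 0, makes a cocycle
    A^(b+1) -> Q lift to the next term, where it is a coboundary up to elements
    that die in Q.  So every map from A^(b+1) to the cogenerator Q that kills
    boundaries kills cycles. *)
Lemma C_exact_acyclic : Prod_resolved_cogenerator C -> acyclic A.
Proof.
move=> [Q [r [Cs [eps [dC [[_ cogQ] ProdC zeroC surj_eps [ex0 exC]]]]]]].
pose Cs' k : rmodType R := if k is k'.+1 then Cs k' else Q.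
pose dC' k : {linear Cs' k.+1 -> Cs' k} :=
  match k return {linear Cs' k.+1 -> Cs' k} with 0 => eps | k'.+1 => dC k' end.
have ProdC' k : (0 < k <= r.+1)%N -> in_Prod C (Cs' k) by case: k => // k; exact: ProdC.
have zeroC' k : (r.+1 < k)%N -> is_zero_mod (Cs' k) by case: k => // k; exact: zeroC.
have exC' k : exact_at (dC' k.+1) (dC' k) by case: k.
move=> b x dx; apply: (cogenerator_separates (S := im_submodule (diff A b)) cogQ).
move=> phi phid.
have exQ : exact_at (dC' 0%N) (\0 : {linear Q -> Q}).
  by move=> q; split=> // _; exact: surj_eps.
have [//|phi0 phi0E] := lift_through_Prod_resolution coresE ProdC' zeroC' exC'
  (k := 0%N) (f := phi) exQ (@eA (b + 1)) _.
have [y|psi [chi phiE]] := resolution_exact ProdC' zeroC' exC' (k := 0%N) (phi := phi0).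
  by rewrite -phi0E; apply: phid; exists y.
rewrite phi0E phiE dx linear0 add0r.
by apply: (exC' 0%N _).2; exists (chi x).
Qed.

End Detection.

(** * The t-structure *)

Section TStructure.
Variables (R : pzRingType) (C : rmodType R).

Lemma DHom_eq0_qis (X Y W : complex R) (s : chain_map X Y) :
  quasi_iso s -> DHom_eq0 X W <-> DHom_eq0 Y W.
Proof.
move=> qs; split=> W0 u.
  by apply: (Dinv_cancelr qs); rewrite (W0 (Dcomp u (Dloc s))) Dloc_0comp.
rewrite -(Deq_idr u) -(Deq_invl qs) Deq_assoc (W0 (Dcomp u (Dinv qs))).
by rewrite Dloc_0comp.
Qed.

Lemma C_exact_shift1 b (X : complex R) : C_exact C b (shift 1 X) <-> C_exact C (b + 1) X.
Proof.
split=> exX phi phid.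
  have [x|psi psiE] := exX phi.
    by rewrite shift1_diff linearN phid oppr0.
  by exists (\- psi) => x; rewrite psiE shift1_diff linearN.
have dE i (x : X (i + 1)) : diff X (i + 1) x = - diff (shift 1 X) i x.
  by rewrite shift1_diff opprK.
have [x|psi psiE] := exX phi; first by rewrite dE linearN phid oppr0.
by exists (\- psi) => x; rewrite psiE dE linearN.
Qed.

(** The three axioms, after replacing every object by an ext-acyclic
    resolution. *)
Lemma big_cotilting_t_structure : big_cotilting C -> t_structure (D_le0 C) (D_ge0 C).
Proof.
move=> [n [[E [eta [d [coresE E0]]]] ext_CC cogC]].
have ext_C I : ext_vanish_above d 0 (I -> C : rmodType R).
  by move=> k _; exact: (ext_CC k.+1 I isT _ _ _ coresE).
have Hom_exact := DHom_eq0_C_exact coresE E0.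
have res X := ext_resolution coresE X E0.
have le0P Z : ext_acyclic d Z ->
    D_le0 C Z <-> forall b, 0 <= b -> C_exact C b Z.
  move=> eZ; split=> [Z0 b b0|exZ j j0].
    apply/(Hom_exact (- (b + 1))); rewrite ?subrr //; apply: Z0.
    by rewrite oppr_lt0 ltzD1.
  apply/(Hom_exact j (- j - 1)); rewrite ?subrK ?addNr //; apply: exZ.
  by rewrite subr_ge0 -[1]add0r lezD1 oppr_gt0.
have ge1P Z : ext_acyclic d Z ->
    D_ge0 C (shift 1 Z) <-> forall b, b < 0 -> C_exact C b Z.
  move=> eZ; have eSZ : ext_acyclic d (shift 1 Z) by move=> i; exact: eZ.
  split=> [Z0 b b0|exZ j j0].
    rewrite -(subrK 1 b); apply/C_exact_shift1/(Hom_exact (- b)) => //.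
      by rewrite subrK subrr.
    by apply: Z0; rewrite oppr_gt0.
  apply/(Hom_exact j (- j - 1)) => //; first by rewrite subrK addNr.
  by apply/C_exact_shift1/exZ; rewrite subrK oppr_lt0.
have le0_qis X Y (s : chain_map X Y) : quasi_iso s -> D_le0 C X <-> D_le0 C Y.
  by move=> qs; split=> H i i0; apply/(DHom_eq0_qis _ qs)/H.
have ge0_qis X Y (s : chain_map X Y) : quasi_iso s -> D_ge0 C X <-> D_ge0 C Y.
  by move=> qs; split=> H i i0; apply/(DHom_eq0_qis _ qs)/H.
split.
- move=> A B A0 B1 u.
  have [B' [sB [eB' qB _]]] := res B.
  have /(ge1P _ eB') exB' : D_ge0 C (shift 1 B').
    exact: (ge0_qis _ _ _ (shift_quasi_iso 1 qB)).2 B1.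
  have [A1 [g [eA1 exA1 _ exA1' lift]]] := truncation ext_C eB'.
  have aA1 : acyclic A1.
    apply: (C_exact_acyclic coresE eA1 _ cogC) => b.
    by have [b0|b0] := leP 0 b; [exact: exA1 | exact: exA1'].
  have [N [s [f [qs _ us]]]] := right_fraction (Dcomp (Dinv qB) u).
  have [Z [t [eZ qt _]]] := res N.
  have qst := comp_quasi_iso qs qt.
  have /(le0P _ eZ) exZ : D_le0 C Z by exact/(le0_qis _ _ _ qst).
  have [alpha alphaE] := lift Z (comp_map f t) exZ.
  have ft0 : Deq (Dloc (comp_map f t)) (Dloc (zero_map Z B')).
    rewrite -(acyclic_factor0 g alpha aA1).
    by apply: Deq_loc_ext => i x; rewrite alphaE.
  have u0 : Deq (Dcomp (Dinv qB) u) (Dloc (zero_map A B')).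
    apply: (Dinv_cancelr qst); rewrite Deq_loc_comp Deq_assoc us -Deq_loc_comp ft0.
    by rewrite -Deq_loc_comp Dloc_0comp.
  rewrite -(Deq_idl u) -(Deq_invr qB) -Deq_assoc u0.
  exact: Dloc_comp0.
- split=> X; have [Z [s [eZ qs _]]] := res X.
    move=> X0; have /(le0P _ eZ) exZ : D_le0 C Z by exact/(le0_qis _ _ _ qs).
    apply/(le0_qis _ _ _ (shift_quasi_iso 1 qs))/le0P; first by move=> i; exact: eZ.
    by move=> b b0; apply/C_exact_shift1/exZ; rewrite addr_ge0.
  move=> X1; have /(ge1P _ eZ) exZ : D_ge0 C (shift 1 Z).
    exact/(ge0_qis _ _ _ (shift_quasi_iso 1 qs)).
  apply/(ge0_qis _ _ _ qs) => j j0.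
  apply/(Hom_exact j (- j - 1)); rewrite ?subrK ?addNr //; apply: exZ.
  by rewrite subr_lt0 (lt_trans _ ltr01) // oppr_lt0.
- move=> X; have [Z [s [eZ qs _]]] := res X.
  have [A [g [eA exA exB _ _]]] := truncation ext_C eZ.
  exists A, (cone g), (Dloc (comp_map s g)), (Dcomp (Dloc (cone_in g)) (Dinv qs)),
    (Dloc (cone_out g)); split.
  + exact/le0P.
  + by apply/ge1P => // i; apply: ext_vanish_prod.
  have iso_id W : Diso (Dloc (id_map W)).
    by exists (Dloc (id_map W)); split; exact: Deq_idl.
  exists A, Z, g, (Dloc (id_map A)), (Dloc s), (Dloc (id_map (cone g))).
  split; split=> //.
  + by exists (Dinv qs); split; [exact: Deq_invl | exact: Deq_invr].
  + by rewrite Deq_idr Deq_loc_comp.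
  + by rewrite Deq_idl -Deq_assoc Deq_invl Deq_idr.
  + rewrite Deq_idr -[Dshift 1 _]/(Dloc (shift_map 1 (id_map A))) -Deq_loc_comp.
    exact: Deq_loc_ext.
Qed.

End TStructure.

Theorem theorem4p5 (R : pzRingType) (C : rmodType R) (hC : big_cotilting C) :
  t_structure (D_le0 C) (D_ge0 C).
Proof. exact: big_cotilting_t_structure. Qed.
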